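(* Let $p$ be an odd prime and let $v>1$ be an integer. There exists a $p$-sun system of $K_v$ if and only if $v\geq 2p$ and $v(v-1)\equiv 0\pmod{4p}$.
   Context: $K_v$ is the complete graph on $v$ vertices. For $k\ge 3$, the $k$-sun is the graph on $2k$ vertices obtained from a cycle $(x_1,\dots,x_k)$ of length $k$ by attaching to each $x_i$ one pendant edge $\{x_i,x_i'\}$, where $x_1',\dots,x_k'$ are $k$ distinct further vertices. A $k$-sun system of a graph $K$ is a set of subgraphs of $K$, each isomorphic to the $k$-sun, whose edge-sets partition the edge-set of $K$. *)

(* Defs.v *)
From HB Require Import structures.
From mathcomp Require Import all_boot.
Set Implicit Arguments.
Unset Strict Implicit.
Unset Printing Implicit Defensive.

Record sgraph := SGraph {
  vertex :> finType;
  adj : rel vertex;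
  adj_sym : symmetric adj;
  adj_irr : irreflexive adj
}.

Definition graph_iso (G H : sgraph) : Prop :=
  exists f : G -> H, bijective f /\ {mono f : x y / adj x y}.

(* An edge is identified with the two-element set of its endpoints. *)
Definition edges (G : sgraph) : {set {set G}} :=
  [set [set xy.1; xy.2] | xy : G * G & adj xy.1 xy.2].

Fact complete_adj_sym v : symmetric (fun x y : 'I_v => x != y).
Proof. by move=> x y; rewrite eq_sym. Qed.

Fact complete_adj_irr v : irreflexive (fun x y : 'I_v => x != y).
Proof. by move=> x; rewrite eqxx. Qed.

Definition complete_graph (v : nat) : sgraph :=
  SGraph (@complete_adj_sym v) (@complete_adj_irr v).

(* [inl i] is the cycle vertex x_i and [inr i] the pendant vertex x_i';
   [ordS] is the cyclic successor on 'I_k.  This is the k-sun for k >= 3; the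
   test [i != j] only matters for k = 1, where it removes a loop. *)
Definition sun_adj (k : nat) : rel ('I_k + 'I_k) := fun x y =>
  match x, y with
  | inl i, inl j => (i != j) && ((j == ordS i) || (i == ordS j))
  | inl i, inr j | inr i, inl j => i == j
  | inr _, inr _ => false
  end.

Fact sun_adj_sym k : symmetric (@sun_adj k).
Proof. by move=> [i|i] [j|j] //=; rewrite eq_sym // orbC. Qed.

Fact sun_adj_irr k : irreflexive (@sun_adj k).
Proof. by move=> [i|i] //=; rewrite eqxx. Qed.

Definition sun (k : nat) : sgraph := SGraph (@sun_adj_sym k) (@sun_adj_irr k).

(* A subgraph is given by the pair (vertex set, edge set). *)
Definition is_subgraph (G : sgraph) (S : {set G} * {set {set G}}) : Prop :=
  S.2 \subset edges G /\ {in S.2, forall e : {set G}, e \subset S.1}.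

Section SubgraphAsGraph.
Variables (G : sgraph) (S : {set G} * {set {set G}}).

Definition sub_adj : rel {x : G | x \in S.1} := fun x y =>
  (x != y) && ([set val x; val y] \in S.2).

Fact sub_adj_sym : symmetric sub_adj.
Proof. by move=> x y; rewrite /sub_adj eq_sym setUC. Qed.

Fact sub_adj_irr : irreflexive sub_adj.
Proof. by move=> x; rewrite /sub_adj eqxx. Qed.

Definition subgraph : sgraph := SGraph sub_adj_sym sub_adj_irr.
End SubgraphAsGraph.

(* [partition] speaks of the set of edge-sets; the injectivity clause says that
   distinct members have distinct edge-sets, so that every edge of K lies in
   exactly one member of B. *)
Definition sun_system (k : nat) (K : sgraph)
    (B : {set {set K} * {set {set K}}}) : Prop :=
  [/\ forall S, S \in B -> is_subgraph S /\ graph_iso (sun k) (subgraph S),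
      {in B &, injective snd}
    & partition [set S.2 | S in B] (edges K)].

(* Main.v *)
Require Import Defs.
From HB Require Import structures.
From mathcomp Require Import all_boot.
From mathcomp Require Import zify ring.

(** The number of edges of K_v is a multiple of 2p and a p-sun has 2p vertices,
    whence the necessity. For the sufficiency write p = 2l + 1 and let Z_p act on
    the vertices: v = p w or v = p w + 1 (one fixed point), with w fibres
    isomorphic to Z_p, except when 4p divides v - 1 or v, where Z_v, resp. Z_(v-1)
    with a fixed point, acts and the edges are partitioned into the orbits of
    suns j = 1..m that realise every difference once. Over the fibres, the cycle
    of a sun can zigzag between the fibres z - r and z + r and close up through
    the fibre z; its differences then form a block, and its pendant edges can be
    sent to a second block with another parameter s. With w = 2q + 1 the
    parameters r = 1..q are paired off. The remaining, and the pure, differences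
    are realised by suns whose cycle is an orbit of Z_p inside one fibre; these
    exist because p is prime. When q is odd the parameter r = 1 is left over
    and its blocks are matched among themselves along the cyclic order of the
    fibres. *)

Set Implicit Arguments.
Unset Strict Implicit.
Unset Printing Implicit Defensive.

(** Only covering is ever verified. The suns are as numerous as the edge count allows, and a
    surjection between finite sets of equal size is injective, so no two suns need to be compared.

    Modulo translation, w = 2q + 1 fibres give w * l pure and w * q * p mixed classes of edges, and
    w more through the fixed point if there is one. A developed sun uses 2p classes, p on its cycle
    and p at its pendant edges; hence blocks of size p, two for each sun. An invariant sun uses just
    one pure and one mixed class, so covering pure differences in this way consumes mixed ones. The
    balance is restored by redirecting pendant edges of developed suns: into their own fibre, where
    they give a pure difference, or to the fixed point. The mixed differences released in this way
    become the pendant differences of the invariant suns. Divisibility by 4 ties the presence of the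
    fixed point to w modulo 4 and to the parity of l, and each combination has its own
    bookkeeping. *)

(** * Edge counts and necessity *)

Lemma edgesP (G : sgraph) (e : {set G}) :
  reflect (exists x y : G, adj x y /\ e = [set x; y]) (e \in edges G).
Proof.
apply: (iffP imsetP) => [[[x y]]|[x [y [xy ->]]]].
  by rewrite inE /= => xy ->; exists x, y.
by exists (x, y); rewrite ?inE.
Qed.

Lemma set2_eq (T : finType) (a b c d : T) :
  [set a; b] = [set c; d] -> (a = c /\ b = d) \/ (a = d /\ b = c).
Proof.
move=> E.
have ha : a \in [set c; d] by rewrite -E set21.
have hb : b \in [set c; d] by rewrite -E set22.
have hc : c \in [set a; b] by rewrite E set21.
have hd : d \in [set a; b] by rewrite E set22.
move: ha hb hc hd; rewrite !inE.
do 4![case/orP=> /eqP ?]; subst; by [left | right].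
Qed.

Lemma mem_edges (G : sgraph) (x y : G) : ([set x; y] \in edges G) = adj x y.
Proof.
apply/edgesP/idP => [[a [b [ab /set2_eq]]]|xy]; last by exists x, y.
by case=> [[-> ->]|[-> ->]] //; rewrite (adj_sym (s := G)).
Qed.

Lemma edges_imset (G H : sgraph) (f : G -> H) :
  bijective f -> {mono f : x y / adj x y} ->
  edges H = (fun e : {set G} => f @: e) @: edges G.
Proof.
move=> [g fK gK] fm; apply/setP=> e; apply/edgesP/imsetP.
  move=> [x [y [xy ->]]]; exists [set g x; g y].
    by rewrite mem_edges -fm !gK.
  by rewrite imsetU !imset_set1 !gK.
move=> [e' /edgesP [x [y [xy ->]]] ->]; exists (f x), (f y).
by rewrite fm imsetU !imset_set1.
Qed.

Lemma card_edges_iso (G H : sgraph) : graph_iso G H -> #|edges H| = #|edges G|.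
Proof.
move=> [f [fb fm]]; rewrite (edges_imset fb fm) card_imset //.
by apply: imset_inj; apply: bij_inj.
Qed.

Lemma card_edges_complete v : (#|edges (complete_graph v)| * 2 = v * (v - 1))%N.
Proof.
have -> : edges (complete_graph v) = [set e : {set 'I_v} | #|e| == 2].
  apply/setP=> e; rewrite inE; apply/edgesP/idP.
    by move=> [x [y [/= xy ->]]]; rewrite cards2 xy.
  case/cards2P=> x [y] [xy ->]; by exists x, y.
rewrite card_draws card_ord bin2 -subn1.
by rewrite muln2 halfK; case: v => // v; rewrite subn1 /= oddM /= andNb subn0.
Qed.

Lemma val_ordS k (i : 'I_k) : ordS i = (if i.+1 == k then 0 else i.+1) :> nat.
Proof.
case: i => i ik /=; case: eqP => [->|ne]; first by rewrite modnn.
by rewrite modn_small // ltn_neqAle ik andbT; apply/eqP.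
Qed.

Definition sun_edge k (x : 'I_k + 'I_k) : 'I_k + 'I_k :=
  match x with inl i => inl (ordS i) | inr i => inl i end.

Lemma sun_adj_edge k (x : sun k) : 2 < k -> adj x (sun_edge x).
Proof.
move=> k2; case: x => i /=; last by rewrite eqxx.
rewrite eqxx andbT; apply/eqP => /(congr1 val).
rewrite [RHS]val_ordS; case: i => i ik /=; case: eqP => ?; lia.
Qed.

Lemma edges_sun k : 2 < k ->
  edges (sun k) = [set [set x; sun_edge x] | x : 'I_k + 'I_k].
Proof.
move=> k2; apply/setP=> e; apply/edgesP/imsetP => [|[x _ ->]]; last first.
  by exists x, (sun_edge x); rewrite sun_adj_edge.
move=> [[x|x] [[y|y]]] /=.
- case=> /andP [_ /orP [] /eqP ->] ->; first by exists (inl x).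
  by exists (inl y) => //; rewrite setUC.
- by case=> /eqP -> ->; exists (inr y) => //; rewrite setUC.
- by case=> /eqP -> ->; exists (inr y).
- by case.
Qed.

Lemma card_edges_sun k : 2 < k -> #|edges (sun k)| = 2 * k.
Proof.
move=> k2; rewrite edges_sun // card_imset.
  by rewrite card_sum card_ord addnn mul2n.
move=> [x|x] [y|y] /set2_eq [] [] // [Ex] [Ey]; rewrite ?Ex //.
have := congr1 val Ex; rewrite [RHS]val_ordS.
have := congr1 val Ey; rewrite [LHS]val_ordS.
clear Ex Ey; case: x => x xk; case: y => y yk /=; do 2!case: eqP => ?; lia.
Qed.

Lemma card_sun k : #|vertex (sun k)| = 2 * k.
Proof. by rewrite card_sum card_ord addnn mul2n. Qed.

(** The isomorphism counts edges of [subgraph S], whose vertices form a sigma type. The images under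
    [val] are exactly [S.2], because members of [S.2] stay inside [S.1] and K has no loops. *)
Lemma card_member (K : sgraph) k (S : {set K} * {set {set K}}) : 2 < k ->
  is_subgraph S -> graph_iso (sun k) (subgraph S) ->
  #|S.2| = 2 * k /\ #|S.1| = 2 * k.
Proof.
move=> k2 [sE sV] iso; split; last first.
  case: (iso) => f [/bij_eq_card]; rewrite card_sun => -> _.
  by rewrite card_sig.
rewrite -(card_edges_sun k2) -(card_edges_iso iso).
rewrite -(card_imset _ (imset_inj (@val_inj _ _ {x : K | x \in S.1}))).
apply: eq_card => e; apply/idP/imsetP => [eS|[e' /edgesP [x [y [/andP [_ xy] ->]]] ->]].
  have /edgesP [x [y [xy De]]] := subsetP sE _ eS.
  have := sV _ eS; rewrite De subUset !sub1set => /andP [xS yS].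
  exists [set exist _ x xS; exist _ y yS]; last by rewrite imsetU !imset_set1.
  apply/edgesP; exists (exist _ x xS), (exist _ y yS); split=> //.
  rewrite /= /sub_adj /= -De eS andbT.
  apply/eqP => /(congr1 val) /= Exy.
  by move: xy; rewrite Exy adj_irr.
by rewrite imsetU !imset_set1.
Qed.

Lemma sun_system_necessary k v (B : {set {set complete_graph v} * {set {set complete_graph v}}}) :
  2 < k -> 1 < v -> sun_system k B -> 2 * k <= v /\ 4 * k %| v * (v - 1).
Proof.
move=> k2 v1 [mem inj part].
have cE : #|edges (complete_graph v)| = #|B| * (2 * k).
  rewrite (card_partition part) big_imset //=.
  rewrite (eq_bigr (fun=> 2 * k)) ?sum_nat_const // => S /mem [sub iso].
  by case: (card_member k2 sub iso).
have cV := card_edges_complete v; split; last first.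
  by rewrite -cV cE -mulnA; apply/dvdnP; exists #|B|; lia.
(* As v > 1, there is an edge to cover, hence a member; its 2k vertices give the bound. *)
have [S SB] : exists S, S \in B.
  apply/set0Pn; rewrite -card_gt0; case: posnP cE => // ->; nia.
have [sub iso] := mem _ SB; have [_ <-] := card_member k2 sub iso.
by apply: leq_trans (max_card _) _; rewrite card_ord.
Qed.

(** * From a covering to a sun system *)

(** The map from pairs (sun, edge of the abstract sun) to edges of K_v is onto by the covering
    hypothesis, and the count makes source and target equally large. It is therefore injective,
    which yields disjointness, distinct edge sets and the partition at once. *)
Lemma sun_system_of_cover k v (I : finType) (P : I -> 'I_k + 'I_k -> 'I_v) :
    2 < k -> (forall i, injective (P i)) ->
    (forall x y : 'I_v, x != y -> exists i s,
      (P i s = x /\ P i (sun_edge s) = y) \/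
      (P i s = y /\ P i (sun_edge s) = x)) ->
    v * (v - 1) = 4 * k * #|I| ->
  exists B : {set {set complete_graph v} * {set {set complete_graph v}}},
    sun_system k B.
Proof.
move=> k2 Pinj cov cnt.
set K := complete_graph v.
pose Q (i : I) (s : sun k) : K := P i s.
have Qinj i : injective (Q i) := Pinj i.
pose F (ie : I * {set sun k}) : {set K} := Q ie.1 @: ie.2.
pose D i : {set {set K}} := (fun e : {set sun k} => Q i @: e) @: edges (sun k).
pose A := setX [set: I] (edges (sun k)).
have FA : F @: A = edges K.
  apply/setP=> e; apply/imsetP/edgesP.
    move=> [[i e'] /setXP [_ /edgesP [s [t [st /= ->]]]] ->].
    exists (Q i s), (Q i t); rewrite /F /= imsetU !imset_set1; split=> //.
    apply/eqP=> /Qinj Est; by rewrite Est adj_irr in st.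
  move=> [x [y [xy ->]]].
  have [i [s Es]] := cov x y xy.
  exists (i, [set s; sun_edge s]).
    by rewrite in_setX inE mem_edges sun_adj_edge.
  rewrite /F /= imsetU !imset_set1 /Q.
  by case: Es => [[-> ->]|[-> ->]] //; rewrite setUC.
have Finj : {in A &, injective F}.
  apply/imset_injP; rewrite FA.
  rewrite /A cardsX cardsT (card_edges_sun k2).
  have cK : #|edges K| * 2 = v * (v - 1) := card_edges_complete v.
  by rewrite -(eqn_pmul2r (isT : 0 < 2)) cK cnt; apply/eqP; ring.
have DA i e : e \in D i -> exists2 e', (i, e') \in A & e = F (i, e').
  by case/imsetP=> e' e'E ->; exists e' => //; rewrite in_setX inE.
have Dne i : D i != set0.
  rewrite -card_gt0 card_imset; last exact: imset_inj.
  by rewrite (card_edges_sun k2); lia.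
have Dtriv i j : D i :&: D j != set0 -> i = j.
  case/set0Pn=> e /setIP [/DA [e1 A1 ->] /DA [e2 A2 /Finj]].
  by move=> /(_ A1 A2) [].
have Dinj : injective D.
  move=> i j Eij; apply: Dtriv; by rewrite Eij setIid.
exists [set (Q i @: [set: sun k], D i) | i : I]; split.
- move=> _ /imsetP [i _ ->]; split; first split=> /=.
  + apply/subsetP=> e /DA [e' e'A ->]; rewrite -FA; exact: imset_f.
  + by move=> e /imsetP [e' _ ->]; apply: imsetS; apply: subsetT.
  + have mem s : Q i s \in Q i @: [set: sun k] by rewrite imset_f.
    pose f (s : sun k) : subgraph (Q i @: [set: sun k], D i) :=
      exist _ (Q i s) (mem s).
    exists f; split.
      apply: inj_card_bij; first by move=> s t [] /Qinj.
      by rewrite card_sig card_imset // cardsT.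
    move=> s t; rewrite /= /sub_adj /=.
    apply/andP/idP => [[_ /imsetP [e /edgesP [a [b [ab ->]]]]]|st].
      have -> : [set Q i s; Q i t] = Q i @: [set s; t].
        by rewrite imsetU !imset_set1.
      move/(imset_inj (@Qinj i)) => E.
      by rewrite -[sun_adj s t]/(adj (s : sun k) t) -mem_edges E mem_edges.
    split; first by apply/eqP => -[/Qinj E]; move: st; rewrite E sun_adj_irr.
    apply/imsetP; exists [set s; t]; last by rewrite imsetU !imset_set1.
    by rewrite mem_edges.
- by move=> _ _ /imsetP [i _ ->] /imsetP [j _ ->] /= /Dinj ->.
- apply/and3P; split.
  + rewrite -FA; apply/eqP/setP=> e; apply/bigcupP/imsetP.
      by move=> [_ /imsetP [_ /imsetP [i _ ->] ->] /= /DA [e' ? ->]]; exists (i, e').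
    move=> [[i e'] /setXP [_ e'E] ->]; exists (D i); last by apply/imsetP; exists e'.
    by apply/imsetP; exists (Q i @: [set: sun k], D i) => //; apply: imset_f.
  + apply/trivIsetP=> _ _ /imsetP [_ /imsetP [i _ ->] ->] /imsetP [_ /imsetP [j _ ->] ->] /=.
    move=> neq; rewrite -setI_eq0; apply: contraNT neq => /Dtriv ->; exact: eqxx.
  + by apply/imsetP=> -[_ /imsetP [i _ ->] /= E]; move: (Dne i); rewrite -E eqxx.
Qed.

(** Transport along an enumeration of [A]. A subset is allowed so that one vertex type with an
    optional fixed point serves both cases: the fixed point is dropped from [A] when it is
    absent. *)
Lemma sun_system_of_cover_in k (T I : finType) (A : {set T})
    (P : I -> 'I_k + 'I_k -> T) :
    2 < k -> A != set0 -> (forall i s, P i s \in A) ->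
    (forall i, injective (P i)) ->
    {in A &, forall x y, x != y -> exists i s,
      (P i s = x /\ P i (sun_edge s) = y) \/
      (P i s = y /\ P i (sun_edge s) = x)} ->
    #|A| * (#|A| - 1) = 4 * k * #|I| ->
  exists B : {set {set complete_graph #|A|} * {set {set complete_graph #|A|}}},
    sun_system k B.
Proof.
move=> k2 /set0Pn [a aA] PA Pinj cov cnt.
pose r := enum_rank_in aA.
apply: (@sun_system_of_cover _ _ I (fun i s => r (P i s))) => //.
  move=> i s t /(congr1 enum_val); rewrite !enum_rankK_in //; exact: Pinj.
move=> x y xy.
have [|i [s H]] := cov (enum_val x) (enum_val y) (enum_valP x) (enum_valP y).
  by apply: contraNneq xy => /enum_val_inj ->.
exists i, s; case: H => [[-> ->]|[-> ->]]; rewrite /r !enum_valK_in; by [left | right].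
Qed.

(** * Developing base suns by translation *)

Definition cycle_succ k n := if n.+1 == k then 0 else n.+1.

(** Primality enters here: every nonzero step generates Z_k, so its multiples form a cycle of full
    length k. *)
Lemma modn_mul_inj k d i j :
  prime k -> 0 < d < k -> i < k -> j < k -> i * d = j * d %[mod k] -> i = j.
Proof.
move=> kp /andP [d0 dk].
have cd : coprime k d by rewrite prime_coprime // gtnNdvd.
wlog ij : i j / i <= j.
  by move=> W ik jk E; case: (leqP i j) => [|/ltnW] ij; [|symmetry]; apply: W.
move=> _ jk /esym /eqP; rewrite eqn_mod_dvd ?leq_mul2r ?ij ?orbT //.
rewrite -mulnBl Gauss_dvdl // => D; case: (posnP (j - i)) => [|h]; first lia.
by have := dvdn_leq h D; lia.
Qed.

Section Development.
Variables (k N' : nat) (X L H : finType) (o : bool).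
Let N := N'.+1.
Variables (pt : L -> bool -> nat -> option (X * nat)).
Variables (sx sy : H -> X) (sd se : H -> nat).

(* A point is a pair (fibre, position) or the fixed point [None]. The base sun f
   has cycle [pt f false n] and pendant vertices [pt f true n]; it is developed
   by all translations of the positions. An element h of H stands for a sun
   invariant under translation: its cycle has step [sd h] in the fibre [sx h], and
   its pendant edges lead to [sy h] with difference [se h]. *)
Definition joins (a b : option (X * nat)) := exists f n, n < k /\
  exists c, (c = pt f false (cycle_succ k n) \/ c = pt f true n) /\
   ((pt f false n = a /\ c = b) \/ (pt f false n = b /\ c = a)).

Definition cov x y e :=
  (exists p q, [/\ p < N, q < N, p + e = q \/ p + e = q + N
                 & joins (Some (x, p)) (Some (y, q))]) \/
  (exists h, x = sx h /\ (y = x /\ e = sd h \/ y = sy h /\ e = se h)).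

(** Edges are undirected: e from x to y is -e from y to x, and the test keeps the representative of
    -e below N. *)
Definition cov2 x y e := cov x y e \/ cov y x (if e == 0 then 0 else N - e).

Hypothesis k2 : 2 < k.
Hypothesis ptI : forall f b b' n n', n < k -> n' < k ->
  pt f b n = pt f b' n' -> b = b' /\ n = n'.
Hypothesis ptN : forall f b n x p, n < k -> pt f b n = Some (x, p) -> p < N.
Hypothesis pto : forall f b n, n < k -> pt f b n = None -> o.
Hypothesis shP : forall h,
  [/\ prime k, k = N, sx h != sy h, 0 < sd h < N & se h < N].
Hypothesis cov_pure : forall x d, 0 < d < N -> cov2 x x d.
Hypothesis cov_mix : forall x y e, x != y -> e < N -> cov2 x y e.
Hypothesis cov_o : o -> forall x, exists p, p < N /\ joins None (Some (x, p)).
Hypothesis X0 : 0 < #|X|.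
Hypothesis count : (N * #|X| + o) * (N * #|X| + o - 1) = 4 * k * (N * #|L| + #|H|).

Let T := option ('I_N * X).
Let rd n : 'I_N := inord (n %% N).

Let val_rd n : rd n = n %% N :> nat.
Proof. by rewrite inordK // ltn_pmod. Qed.

Let real t (c : option (X * nat)) : T :=
  if c is Some (x, p) then Some (rd (p + t), x) else None.

Let P (i : 'I_N * L + H) (s : 'I_k + 'I_k) : T :=
  match i with
  | inl (t, f) => match s with
                  | inl n => real t (pt f false n)
                  | inr n => real t (pt f true n) end
  | inr h => match s with
             | inl n => Some (rd (n * sd h), sx h)
             | inr n => Some (rd (n * sd h + se h), sy h) end
  end.

Let A : {set T} := [set c | o || (c != None)].

Let real_inj t f b b' n n' : n < k -> n' < k ->
  real t (pt f b n) = real t (pt f b' n') -> b = b' /\ n = n'.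
Proof.
move=> nk nk' E; apply: (@ptI f _ _ _ _ nk nk').
case E1: (pt f b n) E => [[x p]|]; case E2: (pt f b' n') => [[y q]|] //=.
case=> Ep <-; move: (congr1 val Ep); rewrite /= !val_rd => /eqP; rewrite eqn_modDr.
by rewrite !modn_small ?(ptN nk E1) ?(ptN nk' E2) // => /eqP ->.
Qed.

Let P_inj i : injective (P i).
Proof.
case: i => [[t f]|h] [n|n] [n'|n'] //=.
1-4: by move/(real_inj (ltn_ord n) (ltn_ord n')) => [// _ /val_inj ->].
all: have [kp kN xy sd0 _] := shP h.
- case=> /(congr1 val) /=; rewrite !val_rd -kN => E; congr inl; apply: val_inj.
  by apply: (modn_mul_inj kp) E; rewrite ?kN // -?kN.
- by case=> _ E; rewrite E eqxx in xy.
- by case=> _ E; rewrite E eqxx in xy.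
- case=> /(congr1 val) /=; rewrite !val_rd -kN => /eqP; rewrite eqn_modDr => /eqP E.
  congr inr; apply: val_inj.
  by apply: (modn_mul_inj kp) E; rewrite ?kN // -?kN.
Qed.

Let P_A i s : P i s \in A.
Proof.
rewrite inE; case: i => [[t f]|h]; case: s => n //=; rewrite ?orbT //.
  case E: (pt f false n) => [[x p]|] /=; first by rewrite orbT.
  by rewrite (pto (ltn_ord n) E).
case E: (pt f true n) => [[x p]|] /=; first by rewrite orbT.
by rewrite (pto (ltn_ord n) E).
Qed.

Let linked (a b : T) := exists i s,
  (P i s = a /\ P i (sun_edge s) = b) \/ (P i s = b /\ P i (sun_edge s) = a).

Let joins_linked t a b : joins a b -> linked (real t a) (real t b).
Proof.
move=> [f [n [nk [c [Ec H1]]]]]; exists (inl (inord (t %% N), f)).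
have R c' : real (inord (t %% N) : 'I_N) c' = real t c'.
  by case: c' => [[x p]|] //=; congr (Some (_, _)); apply: val_inj;
    rewrite /= !val_rd modnDmr.
case: Ec => Ec.
  exists (inl (Ordinal nk)) => /=; rewrite [(n.+1 %% k)](val_ordS (Ordinal nk)).
  rewrite -/(cycle_succ k n) -Ec !R.
  by case: H1 => [[-> ->]|[-> ->]]; [left | right].
exists (inr (Ordinal nk)) => /=; rewrite -Ec !R.
by case: H1 => [[-> ->]|[-> ->]]; [right | left].
Qed.

Let cov_linked x y (i j : 'I_N) :
  cov x y ((j + N - i) %% N) -> linked (Some (i, x)) (Some (j, y)).
Proof.
have iN := ltn_ord i; have jN := ltn_ord j.
set e := (_ %% N).
have Ee : (i + e) %% N = j.
  rewrite /e modnDmr subnKC; last by lia.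
  by rewrite modnDr modn_small.
case=> [[p [q [pN qN Epq J]]]|[h [Ex Hy]]].
  (* Translation by i - p, shifted by N to remain a natural number, moves the base edge onto the
     given one. *)
  have := @joins_linked (i + N - p) _ _ J; rewrite /=.
  have E1 : (p + (i + N - p)) %% N = i.
    by rewrite subnKC; [rewrite modnDr modn_small | lia].
  have -> : rd (p + (i + N - p)) = i by apply: val_inj; rewrite /= val_rd.
  have -> // : rd (q + (i + N - p)) = j.
  apply: val_inj; rewrite /= val_rd -Ee -[in RHS]E1 modnDml.
  case: Epq => Epq.
    by congr (_ %% _); lia.
  by rewrite -(modnDr (q + _)); congr (_ %% _); lia.
have [kp kN xy sd0 _] := shP h.
(* An injective map between sets of size k = N is onto, so the invariant sun itself passes through
   position i and needs no translate. *)
have [n En] : exists n : 'I_k, n * sd h = i %[mod N].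
  have inj : injective (fun n : 'I_k => rd (n * sd h)).
    move=> a b /(congr1 val) /=; rewrite !val_rd -kN => E; apply: val_inj.
    by apply: (modn_mul_inj kp) E; rewrite ?kN // -?kN.
  have [|g _ gK] := inj_card_bij inj; first by rewrite !card_ord kN.
  by exists (g i); have := congr1 val (gK i); rewrite /= val_rd (modn_small iN).
have R1 : rd (n * sd h) = i by apply: val_inj; rewrite /= val_rd En modn_small.
exists (inr h); case: Hy => [[Ey Ed]|[Ey Ed]].
  exists (inl n); left => /=; rewrite R1 Ey Ex; split=> //.
  congr (Some (_, _)); apply: val_inj; rewrite /= val_rd.
  have -> : n.+1 %% k = n.+1 %% N by congr (_ %% _).
  by rewrite modnMml -[RHS]Ee mulSn addnC -modnDml En modnDml Ed.
exists (inr n); right => /=; rewrite R1 Ey Ex; split=> //.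
congr (Some (_, _)); apply: val_inj; rewrite /= val_rd.
by rewrite -modnDml En modnDml -Ed.
Qed.

Lemma development_system :
  exists B : {set {set complete_graph (N * #|X| + o)} *
                  {set {set complete_graph (N * #|X| + o)}}}, sun_system k B.
Proof.
have cA : #|A| = N * #|X| + o.
  case: (o) @A => A'.
    have -> : A' = setT by apply/setP=> c; rewrite !inE.
    by rewrite cardsT card_option card_prod card_ord addn1.
  have -> : A' = setT :\ None by apply/setP=> c; rewrite !inE andbT.
  have := cardsD1 None [set: T].
  rewrite cardsT card_option card_prod card_ord inE add1n addn0 => -[E]; exact: esym E.
rewrite -cA; apply: (sun_system_of_cover_in (P := P)) => //.
- by rewrite -card_gt0 cA; lia.
- move=> a b aA bA ab; change (linked a b).
  have linkedC c d : linked c d -> linked d c.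
    by move=> [i [s [?|?]]]; exists i, s; [right|left].
  case: a b aA bA ab => [[i x]|] [[j y]|] //.
  + move=> _ _ ij.
    set e := (j + N - i) %% N.
    have iN := ltn_ord i; have jN := ltn_ord j.
    have Ee : (i + e) %% N = j.
      rewrite /e modnDmr subnKC; last by lia.
      by rewrite modnDr modn_small.
    have eN : e < N by rewrite ltn_pmod.
    have : cov2 x y e.
      case: (eqVneq x y) => [Exy|xy]; last exact: cov_mix.
      rewrite Exy; apply: cov_pure; rewrite eN andbT lt0n.
      apply: contraNneq ij => e0; rewrite e0 addn0 modn_small // in Ee.
      by apply/eqP; congr (Some (_, _)); [exact: val_inj |].
    case=> [|C]; first exact: cov_linked.
    apply: linkedC; apply: cov_linked.
    suff -> : (i + N - j) %% N = (if e == 0 then 0 else N - e) by [].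
    rewrite -Ee; case: eqP => [->|/eqP e0].
      by rewrite addn0 (modn_small iN) addKn modnn.
    case: (ltnP (i + e) N) => ie.
      rewrite (modn_small ie) modn_small; lia.
    have -> : (i + e) %% N = i + e - N.
      by rewrite -[in LHS](subnK ie) modnDr modn_small; lia.
    have -> : i + N - (i + e - N) = N - e + N by lia.
    by rewrite modnDr modn_small; lia.
  + rewrite !inE /= => _; rewrite orbF => oo _.
    have [p [pN J]] := cov_o oo x; apply: linkedC.
    have := @joins_linked (i + N - p) _ _ J; rewrite /=.
    suff -> : rd (p + (i + N - p)) = i by [].
    apply: val_inj; have iN := ltn_ord i.
    by rewrite /= val_rd subnKC; [rewrite modnDr modn_small | lia].
  + rewrite !inE /= orbF => oo _ _.
    have [p [pN J]] := cov_o oo y.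
    have := @joins_linked (j + N - p) _ _ J; rewrite /=.
    suff -> : rd (p + (j + N - p)) = j by [].
    apply: val_inj; have jN := ltn_ord j.
    by rewrite /= val_rd subnKC; [rewrite modnDr modn_small | lia].
- by rewrite cA count card_sum card_prod card_ord.
Qed.

End Development.

(** * Zigzag cycles between two fibres *)

(* The cycle is U 0, V (l - 1), U 1, V (l - 2), ..., U (l - 1), V 0, Z. *)
Definition zigzag (T : Type) l (U V : bool -> nat -> T) (Z : bool -> T) b n :=
  if n == 2 * l then Z b else if odd n then V b (l - 1 - n./2) else U b n./2.

Lemma zigzag_inj T l (U V : bool -> nat -> T) (Z : bool -> T) :
    (forall b b' i j, i < l -> j < l -> U b i = U b' j -> b = b' /\ i = j) ->
    (forall b b' i j, i < l -> j < l -> V b i = V b' j -> b = b' /\ i = j) ->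
    Z false <> Z true ->
    (forall b b' i j, i < l -> j < l -> U b i <> V b' j) ->
    (forall b b' i, i < l -> U b i <> Z b') ->
    (forall b b' i, i < l -> V b i <> Z b') ->
  forall b b' n n', n < (2 * l).+1 -> n' < (2 * l).+1 ->
  zigzag l U V Z b n = zigzag l U V Z b' n' -> b = b' /\ n = n'.
Proof.
move=> UU VV ZZ UV UZ VZ b b' n n' nl nl'; rewrite /zigzag.
have ZZ' : Z b = Z b' -> b = b' by case: b b' => [] [] // /esym.
have oddE a : a = odd a + a./2.*2 by rewrite odd_double_half.
have := oddE n; have := oddE n'.
case: (eqVneq n (2 * l)) => [->|h]; case: (eqVneq n' (2 * l)) => [->|h'];
  case: (odd n) => /=; case: (odd n') => /= E1 E2 E; try by [split; auto].
all: try by [case: (@UZ b b' n./2); [lia | rewrite E] | case: (@UZ b' b n'./2); [lia | rewrite E]].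
all: try by [case: (@VZ b b' (l - 1 - n./2)); [lia | rewrite E]
  | case: (@VZ b' b (l - 1 - n'./2)); [lia | rewrite E]].
all: try by [case: (@UV b b' n./2 (l - 1 - n'./2)); [lia | lia | rewrite E]
  | case: (@UV b' b n'./2 (l - 1 - n./2)); [lia | lia | rewrite E]].
- by have [||-> ?] := VV _ _ _ _ _ _ E; [lia | lia | split; lia].
- by have [||-> ?] := UU _ _ _ _ _ _ E; [lia | lia | split; lia].
Qed.

Section Zigzag.
Variables (l : nat) (X L H : finType).
Variables (pt : L -> bool -> nat -> option (X * nat)).
Variables (sx sy : H -> X) (sd se : H -> nat).
Let k := (2 * l).+1.
Let joins := joins k pt.
Let cov2 := cov2 k (2 * l) pt sx sy sd se.

Lemma joins_sym a b : joins a b -> joins b a.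
Proof.
move=> [f [n [nk [c [Ec H1]]]]]; exists f, n; split=> //; exists c; split=> //.
by case: H1; [right | left].
Qed.

Lemma cov2_joins x y p q e : p < k -> q < k -> p + e = q \/ p + e = q + k ->
  joins (Some (x, p)) (Some (y, q)) -> cov2 x y e.
Proof. by move=> pk qk E J; left; left; exists p, q. Qed.

Lemma cov2_pure h d : sd h = d \/ d + sd h = k -> 0 < d < k ->
  cov2 (sx h) (sx h) d.
Proof.
move=> Ed d0; case: Ed => Ed; [left | right]; right; exists h; split=> //; left.
  by [].
split=> //; case: eqP => ?; rewrite -/k; lia.
Qed.

Lemma cov2_pendant h : cov2 (sx h) (sy h) (se h).
Proof. by left; right; exists h; split=> //; right. Qed.

Lemma cov2_sym x y e e' : e < k -> e' < k -> e + e' = 0 \/ e + e' = k ->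
  cov2 x y e -> cov2 y x e'.
Proof.
move=> ek ek' E [C|C]; [right | left].
  suff -> : (if e' == 0 then 0 else (2 * l).+1 - e') = e by [].
  by case: eqP => ?; rewrite /k in E ek ek' *; lia.
suff -> : e' = (if e == 0 then 0 else (2 * l).+1 - e) by [].
by case: eqP => ?; rewrite /k in E ek ek' *; lia.
Qed.

Section OneSun.
Variables (f : L) (U V : bool -> nat -> option (X * nat)).
Variables (Z : bool -> option (X * nat)).
Hypothesis l0 : 0 < l.
Hypothesis ptE : pt f = zigzag l U V Z.

Let zE b n i : n = i.*2 -> i < l -> zigzag l U V Z b n = U b i.
Proof.
by move=> -> il; rewrite /zigzag; case: eqP => [|_]; [lia | rewrite odd_double doubleK].
Qed.

Let zO b n i : n = (l - 1 - i).*2.+1 -> i < l -> zigzag l U V Z b n = V b i.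
Proof.
move=> -> il; rewrite /zigzag; case: eqP => [|_]; first lia.
by rewrite /= odd_double /= uphalf_double; congr V; lia.
Qed.

Let zZ b n : n = 2 * l -> zigzag l U V Z b n = Z b.
Proof. by move=> ->; rewrite /zigzag eqxx. Qed.

Let joins_next n c : n < k -> c = pt f false (cycle_succ k n) ->
  joins (pt f false n) c.
Proof. by move=> nk Ec; exists f, n; split=> //; exists c; split; [left | left]. Qed.

Let succE n m : m = n.+1 -> n < 2 * l -> cycle_succ k n = m.
Proof. by move=> -> nl; rewrite /cycle_succ; case: eqP; rewrite /k; lia. Qed.

Lemma joins_UU i : i < l -> joins (U false i) (U true i).
Proof.
move=> il; exists f, i.*2; split; first by rewrite /k; lia.
by exists (U true i); rewrite ptE !(zE _ (erefl _)) //; split; [right | left].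
Qed.

Lemma joins_VV i : i < l -> joins (V false i) (V true i).
Proof.
move=> il; exists f, (l - 1 - i).*2.+1; split; first by rewrite /k; lia.
by exists (V true i); rewrite ptE !(zO _ (erefl _)) //; split; [right | left].
Qed.

Lemma joins_ZZ : joins (Z false) (Z true).
Proof.
exists f, (2 * l); split; first by rewrite /k; lia.
by exists (Z true); rewrite ptE !(zZ _ (erefl _)) //; split; [right | left].
Qed.

(** [U i] has cycle index 2i and [V j] has 2(l - 1 - j) + 1. These are consecutive when i + j = l -
    1, with [V] after [U], or i + j = l, with [U] after [V]. *)
Lemma joins_UV i j : i < l -> j < l -> i + j = l - 1 \/ i + j = l ->
  joins (U false i) (V false j).
Proof.
move=> il jl; case=> E.
  rewrite -(@zE _ i.*2 i) // -(@zO _ i.*2.+1 j) //; last lia.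
  rewrite -ptE; apply: joins_next; first by rewrite /k; lia.
  by rewrite (@succE _ i.*2.+1) //; lia.
apply: joins_sym; rewrite -(@zE _ i.*2 i) // -(@zO _ i.-1.*2.+1 j) //; last lia.
rewrite -ptE; apply: joins_next; first by rewrite /k; lia.
by rewrite (@succE _ i.*2) //; lia.
Qed.

Lemma joins_UZ : joins (U false 0) (Z false).
Proof.
apply: joins_sym; rewrite -(@zE _ 0 0) // -(@zZ _ (2 * l)) // -ptE.
apply: joins_next; first by rewrite /k; lia.
by rewrite /cycle_succ /k eqxx.
Qed.

Lemma joins_VZ : joins (V false 0) (Z false).
Proof.
rewrite -(@zO _ (2 * l).-1 0) //; last lia.
rewrite -(@zZ _ (2 * l)) // -ptE.
apply: joins_next; first by rewrite /k; lia.
by rewrite (@succE _ (2 * l)) //; lia.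
Qed.

(** Along the cycle j - i takes the values l - 1, l - 2, ..., -(l - 1), each once. The parity of the
    difference decides whether i + j is l - 1 or l. *)
Lemma cov2_zigzag u v e :
    (forall i, i < l -> U false i = Some (u, i)) ->
    (forall i, i < l -> V false i = Some (v, i)) ->
  e < l \/ l.+1 < e < k -> cov2 u v e.
Proof.
move=> EU EV.
have C i j : i < l -> j < l -> i + j = l - 1 \/ i + j = l ->
    i + e = j \/ i + e = j + k -> cov2 u v e.
  move=> il jl ij E; apply: (@cov2_joins _ _ i j) => //; try by rewrite /k; lia.
  by rewrite -EU // -EV //; apply: joins_UV.
case=> el.
  have := odd_double_half (l - 1 - e); case: (odd _) => /= E.
    by apply: (C (l - 1 - e)./2.+1 (l - (l - 1 - e)./2.+1)); lia.
  by apply: (C (l - 1 - e)./2 (l - 1 - (l - 1 - e)./2)); lia.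
rewrite {1}/k in el.
have := odd_double_half (e - l.+2); case: (odd _) => /= E.
  apply: (C (l - (e - l.+2)./2.+1) (e - l.+2)./2.+1); rewrite /k; lia.
apply: (C (l - 1 - (e - l.+2)./2) (e - l.+2)./2); rewrite /k; lia.
Qed.

End OneSun.

End Zigzag.

(** * Fibres modulo w and the partition into blocks *)

Definition fiber w' n : 'I_w'.+1 := inord (n %% w'.+1).

Lemma val_fiber w' n : fiber w' n = n %% w'.+1 :> nat.
Proof. by rewrite inordK // ltn_pmod. Qed.

Lemma fiberK w' (x : 'I_w'.+1) : fiber w' x = x.
Proof. by apply: val_inj; rewrite /= val_fiber modn_small. Qed.

Lemma fiber_addw w' n : fiber w' (n + w'.+1) = fiber w' n.
Proof. by apply: val_inj; rewrite /= !val_fiber modnDr. Qed.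

Lemma fiber_inj w' m n : m < w'.+1 -> n < w'.+1 -> fiber w' m = fiber w' n -> m = n.
Proof. by move=> mw nw /(congr1 val); rewrite /= !val_fiber !modn_small. Qed.

Lemma fiber_addl w' z m n : fiber w' (z + m) = fiber w' (z + n) -> fiber w' m = fiber w' n.
Proof.
move=> /(congr1 val); rewrite /= !val_fiber => /eqP; rewrite eqn_modDl => /eqP E.
by apply: val_inj; rewrite /= !val_fiber.
Qed.

(** Fibres such as z - r + 2s are written z + (w - r + 2s), with offset below 3w. The congruence
    thus splits into five linear cases that [lia] can handle. *)
Lemma fiber_eq w' m n : fiber w' m = fiber w' n ->
  m < 3 * w'.+1 -> n < 3 * w'.+1 ->
  m = n \/ m = n + w'.+1 \/ m = n + 2 * w'.+1 \/ n = m + w'.+1 \/ n = m + 2 * w'.+1.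
Proof.
move=> /(congr1 val); rewrite /= !val_fiber => E mw nw.
have : m %/ w'.+1 < 3 by rewrite ltn_divLR.
have : n %/ w'.+1 < 3 by rewrite ltn_divLR.
move: (divn_eq m w'.+1) (divn_eq n w'.+1); rewrite E.
move: (n %% _) (m %/ _) (n %/ _) => t a b.
by case: a => [|[|[|?]]]; case: b => [|[|[|?]]] // -> -> _ _; lia.
Qed.

(* The edges between the fibres of a pair [z - r, z + r] with differences other
   than l and -l, together with those of difference l from [z - r] and from
   [z + r] to the midpoint [z], form a block of 2l + 1 classes; the blocks
   partition all edges between distinct fibres. *)
Definition block_covered l q (cv : 'I_(2 * q).+1 -> 'I_(2 * q).+1 -> nat -> Prop) z r :=
  [/\ forall e, e < l \/ l.+1 < e < (2 * l).+1 ->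
        cv (fiber (2 * q) (z + ((2 * q).+1 - r))) (fiber (2 * q) (z + r)) e,
      cv (fiber (2 * q) (z + ((2 * q).+1 - r))) (fiber (2 * q) z) l
    & cv (fiber (2 * q) (z + r)) (fiber (2 * q) z) l].

Section Blocks.
Variables (q : nat) (L H : finType).
Let X : finType := 'I_(2 * q).+1.
Variables (l : nat) (pt : L -> bool -> nat -> option (X * nat)).
Variables (sx sy : H -> X) (sd se : H -> nat).
Let w := (2 * q).+1.
Let fb : nat -> X := fiber (2 * q).
Let cov2 := cov2 (2 * l).+1 (2 * l) pt sx sy sd se.

(** As w is odd, two distinct fibres are z - r and z + r for a unique midpoint z and a unique r with
    0 < r <= q; this settles the differences other than l and -l. The difference l from x to y
    belongs to the block with midpoint y, since x is y + r or y - r; and -l is l read from y to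
    x. *)
Lemma cov_mix_blocks :
    (forall z r, z < w -> 0 < r <= q -> block_covered l cov2 z r) ->
  forall x y e, x != y -> e < (2 * l).+1 -> cov2 x y e.
Proof.
move=> B.
have T (x y : X) : x != y -> cov2 x y l.
  move=> xy; have xy' : x <> y :> nat by move=> E; rewrite (val_inj E) eqxx in xy.
  have xw := ltn_ord x; have yw := ltn_ord y.
  have S1 r : 0 < r <= q -> x = r + y %[mod w] -> cov2 x y l.
    move=> rq E; have [_ _] := B y r yw rq.
    rewrite -/(fb (y + r)) -/(fb y); have -> : fb (y + r) = x.
      by apply: val_inj; rewrite /= val_fiber addnC -E modn_small.
    by rewrite /fb fiberK.
  have S2 r : 0 < r <= q -> x + r = y %[mod w] -> cov2 x y l.
    move=> rq E; have [_ + _] := B y r yw rq.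
    rewrite -/w addnBA; last by rewrite /w; lia.
    rewrite -/(fb (y + w - r)) -/(fb y); have -> : fb (y + w - r) = x.
      apply: val_inj; rewrite /= val_fiber -[RHS](modn_small xw).
      apply/eqP; rewrite -(eqn_modDr r) E subnK; last by rewrite /w; lia.
      by rewrite modnDr.
    by rewrite /fb fiberK.
  case: (ltnP x y) => [lt|ge].
    case: (leqP (y - x) q) => h.
      by apply: (S2 (y - x)); [lia | congr (_ %% _); lia].
    apply: (S1 (w - (y - x))); first by rewrite /w; lia.
    by rewrite -(modnDr x); congr (_ %% _); rewrite /w; lia.
  case: (leqP (x - y) q) => h.
    by apply: (S1 (x - y)); [lia | congr (_ %% _); lia].
  apply: (S2 (w - (x - y))); first by rewrite /w; lia.
  by rewrite -[in RHS](modnDr y); congr (_ %% _); rewrite /w; lia.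
have M (x y : X) : x != y -> (forall e, e < l \/ l.+1 < e < (2 * l).+1 -> cov2 x y e) \/
    (forall e, e < l \/ l.+1 < e < (2 * l).+1 -> cov2 y x e).
  wlog lt : x y / x < y.
    move=> W xy; have yx : y != x by rewrite eq_sym.
    case: (ltngtP x y) => [lt|gt|/val_inj E]; first exact: W.
      by case: (W y x gt yx); [right | left].
    by rewrite E eqxx in xy.
  move=> _; have xw := ltn_ord x; have yw := ltn_ord y.
  (* For odd y - x = 2a + 1 the midpoint lies on the other arc, from y round to x, so x and y change
     roles and r = q - a. *)
  have := odd_double_half (y - x); case: (odd _) => /=.
    move: (_./2) => a E; right=> e eM.
    have r0 : 0 < q - a <= q by lia.
    have [/(_ e eM) + _ _] := B ((y + (q - a)) %% w) (q - a) (ltn_pmod _ (ltn0Sn _)) r0.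
    rewrite -/w addnBA; last by rewrite /w; lia.
    rewrite -/(fb ((y + (q - a)) %% w + w - (q - a))) -/(fb ((y + (q - a)) %% w + (q - a))).
    have -> : fb ((y + (q - a)) %% w + w - (q - a)) = y.
      apply: val_inj; rewrite /= val_fiber -addnBA; last by rewrite /w; lia.
      rewrite modnDml -[RHS](modn_small yw) -[in RHS](modnDr y).
      by congr (_ %% _); rewrite /w; lia.
    suff -> : fb ((y + (q - a)) %% w + (q - a)) = x by [].
    apply: val_inj; rewrite /= val_fiber modnDml.
    rewrite -[RHS](modn_small xw) -[in RHS](modnDr x).
    by congr (_ %% _); rewrite /w; lia.
  move: (_./2) => a; rewrite add0n => E; left=> e eM.
  have r0 : 0 < a <= q by lia.
  have zw : x + a < w by rewrite /w; lia.
  have [/(_ e eM) + _ _] := B (x + a) a zw r0.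
  rewrite -/w addnBA; last by rewrite /w; lia.
  rewrite -/(fb (x + a + w - a)) -/(fb (x + a + a)).
  have -> : fb (x + a + w - a) = x.
    rewrite -[RHS]fiberK -[in RHS]fiber_addw; congr fiber; rewrite /w; lia.
  suff -> : fb (x + a + a) = y by [].
  by rewrite -[RHS]fiberK; congr fiber; lia.
move=> x y e xy ek.
have yx : y != x by rewrite eq_sym.
case: (eqVneq e l) => [->|el]; first exact: T.
case: (eqVneq e l.+1) => [->|el'].
  apply: cov2_sym (T _ _ yx); lia.
have eM : e < l \/ l.+1 < e < (2 * l).+1 by lia.
case: (M _ _ xy) => C; first exact: C.
case: (eqVneq e 0) => [e0|e0].
  by apply: cov2_sym (C 0 _); lia.
by apply: cov2_sym (C ((2 * l).+1 - e) _); lia.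
Qed.

End Blocks.

(** Since k is odd, exactly one of d and k - d is even, so the pure differences 2(l - i) with i < l
    suffice. This is the form that arises from an edge between the positions i and 2l - i. *)
Lemma cyclic_fiber_system l w' (L H : finType) (o : bool)
    (pt : L -> bool -> nat -> option ('I_w'.+1 * nat))
    (sx sy : H -> 'I_w'.+1) (sd se : H -> nat) (k := (2 * l).+1) :
    prime k -> 0 < l ->
    (forall f b b' n n', n < k -> n' < k -> pt f b n = pt f b' n' -> b = b' /\ n = n') ->
    (forall f b n x p, n < k -> pt f b n = Some (x, p) -> p < k) ->
    (forall f b n, n < k -> pt f b n = None -> o) ->
    (forall h, [/\ sx h != sy h, 0 < sd h < k & se h < k]) ->
    (forall x i, i < l -> cov2 k (2 * l) pt sx sy sd se x x (2 * (l - i))) ->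
    (forall x y e, x != y -> e < k -> cov2 k (2 * l) pt sx sy sd se x y e) ->
    (o -> forall x, exists p, p < k /\ joins k pt None (Some (x, p))) ->
    (k * w'.+1 + o) * (k * w'.+1 + o - 1) = 4 * k * (k * #|L| + #|H|) ->
  exists B : {set {set complete_graph (k * w'.+1 + o)} *
                  {set {set complete_graph (k * w'.+1 + o)}}}, sun_system k B.
Proof.
move=> kp l0 ptI ptN pto shP pure mix co cnt.
have := @development_system k (2 * l) 'I_w'.+1 L H o pt sx sy sd se.
rewrite card_ord; apply=> //; first by rewrite /k; lia.
  by move=> h; have [] := shP h.
move=> x d d0; have := odd_double_half d; case: (odd d) => /= E.
  apply: (@cov2_sym _ _ _ _ _ _ _ _ _ _ _ (2 * (l - d./2))); try by rewrite ?/k; lia.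
  by apply: pure; lia.
have -> : d = 2 * (l - (l - d./2)) by lia.
by apply: pure; lia.
Qed.

Lemma fiber_pt_eq w' (c c' p p' : nat) :
  Some (fiber w' c, p) = Some (fiber w' c', p') ->
  c < 3 * w'.+1 -> c' < 3 * w'.+1 -> p = p' /\
  (c = c' \/ c = c' + w'.+1 \/ c = c' + 2 * w'.+1 \/ c' = c + w'.+1 \/ c' = c + 2 * w'.+1).
Proof. by move=> [E ->] *; split=> //; exact: fiber_eq. Qed.

Lemma fiber_pt_addl w' (z c c' p p' : nat) :
  Some (fiber w' (z + c), p) = Some (fiber w' (z + c'), p') ->
  c < 3 * w'.+1 -> c' < 3 * w'.+1 -> p = p' /\
  (c = c' \/ c = c' + w'.+1 \/ c = c' + 2 * w'.+1 \/ c' = c + w'.+1 \/ c' = c + 2 * w'.+1).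
Proof.
by move=> [E Ep]; apply: fiber_pt_eq; rewrite (fiber_addl E) Ep.
Qed.

(** * The sun of a pair of parameters (r, s) *)

Section GenericSun.
Variables (l q z r s : nat).
Let w := (2 * q).+1.
Let fb : nat -> 'I_w := fiber (2 * q).
Variable HU : nat -> option ('I_w * nat).

(* The cycle of this sun covers the block (z, r); its pendant edges, taken over
   all z, cover all the blocks with parameter s. *)
Definition gU (b : bool) i := if b then HU i else Some (fb (z + (w - r)), i).
Definition gV (b : bool) i :=
  if b then if i == 0 then Some (fb (z + (r + w - s)), l)
            else Some (fb (z + (r + 2 * w - 2 * s)), 2 * i)
  else Some (fb (z + r), i).
Definition gZ (b : bool) :=
  if b then Some (fb (z + s), 2 * l) else Some (fb (z + 0), l).

(** Two possible heads for the pendant edge at position i of the fibre z - r: [gHU] gives difference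
    i in the block (z - r + s, s), [pureU] gives the pure difference 2(l - i). *)
Definition gHU i : option ('I_w * nat) := Some (fb (z + (w - r + 2 * s)), 2 * i).
Definition pureU i : option ('I_w * nat) := Some (fb (z + (w - r)), 2 * l - i).

Hypothesis HUE : forall i, i < l -> [\/ HU i = gHU i, HU i = pureU i | HU i = None].
Lemma generic_sun_lt b n x p : n < (2 * l).+1 ->
  zigzag l gU gV gZ b n = Some (x, p) -> p < (2 * l).+1.
Proof.
move=> nl; rewrite /zigzag; have := odd_double_half n.
case: eqP => [_ _|nE]; first by case: b => -[_ <-]; lia.
case: (odd n) => /= En; rewrite /gV /gU; case: b; do ?case: eqP => ?; try by case=> _ <-; lia.
by case: (@HUE n./2) => [|->|->|-> //]; [lia | | ]; case=> _ <-; lia.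
Qed.

Lemma generic_sun_None b n : zigzag l gU gV gZ b n = None ->
  exists2 i, n = i.*2 & HU i = None.
Proof.
rewrite /zigzag; have := odd_double_half n.
case: eqP => [_ _|nE]; first by case: b.
case: (odd n) => /= En; rewrite /gV /gU; case: b; do ?case: eqP => ?; try by [].
by exists n./2 => //; rewrite -En.
Qed.
Hypothesis HU1 : forall i j, i < l -> j < l -> HU i = None -> HU j = None -> i = j.
Hypotheses (r0 : 0 < r <= q) (s0 : 0 < s <= q) (rs : r <> s) (sr : 2 * s <> r)
  (rs3 : 2 * r <> 3 * s) (rs3' : 3 * s <> 2 * r + w).

(** Relative to z, the cycle lies over -r, r, 0 and the heads over 2s - r (or -r), r - 2s, r - s, s.
    The condition r <> s separates the head of [V 0] from [Z], both at position l; 2s <> r separates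
    2s - r, r - 2s and 0; the last two conditions say that 3s and 2r differ modulo w, which
    separates 2s - r from r - s. Positions and the bounds on r and s exclude the rest. *)
Lemma generic_sun_inj b b' n n' : n < (2 * l).+1 -> n' < (2 * l).+1 ->
  zigzag l gU gV gZ b n = zigzag l gU gV gZ b' n' -> b = b' /\ n = n'.
Proof.
have ww : w = (2 * q).+1 by [].
apply: zigzag_inj => {b b' n n'}.
- move=> b b' i j il jl; rewrite /gU; case: b b' => [] [].
  + case: (HUE il) => Ei; case: (HUE jl) => Ej E; split=> //; move: (E); rewrite ?Ei ?Ej //.
    1-4: by move/fiber_pt_addl; rewrite /w; lia.
    by move=> _; exact: HU1.
  + case: (HUE il) => -> // /fiber_pt_addl; rewrite /w; lia.
  + case: (HUE jl) => -> // /fiber_pt_addl; rewrite /w; lia.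
  + by case.
- move=> b b' i j il jl; rewrite /gV; case: b b' => [] []; do ?case: eqP => ?;
    move/fiber_pt_addl; rewrite /w; lia.
- move/fiber_pt_addl; rewrite /w; lia.
- move=> b b' i j il jl; rewrite /gU /gV; case: b b' => [] []; do ?case: eqP => ?;
    first [case: (HUE il) => -> | idtac]; try by [];
    move/fiber_pt_addl; rewrite /w; lia.
- move=> b b' i il; rewrite /gU /gZ; case: b b' => [] [];
    first [case: (HUE il) => -> | idtac]; try by [];
    move/fiber_pt_addl; rewrite /w; lia.
- move=> b b' i il; rewrite /gV /gZ; case: b b' => [] []; do ?case: eqP => ?;
    move/fiber_pt_addl; rewrite /w; lia.
Qed.

End GenericSun.

Section GenericCover.
Variables (l q : nat) (L H : finType).
Let w := (2 * q).+1.
Let fb : nat -> 'I_w := fiber (2 * q).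
Variables (pt : L -> bool -> nat -> option ('I_w * nat)).
Variables (sx sy : H -> 'I_w) (sd se : H -> nat).
Let cv := cov2 (2 * l).+1 (2 * l) pt sx sy sd se.
Hypothesis l0 : 0 < l.

Lemma fiber_shift m n : m = n \/ m = n + w \/ n = m + w \/ m = n + w + w \/ n = m + w + w ->
  fb m = fb n.
Proof. by case=> [->|[->|[->|[->|->]]]] //; rewrite /fb !fiber_addw. Qed.

Lemma block_cycle f z r (U V : bool -> nat -> option ('I_w * nat))
    (Z : bool -> option ('I_w * nat)) :
  pt f = zigzag l U V Z ->
  (forall i, i < l -> U false i = Some (fb (z + (w - r)), i)) ->
  (forall i, i < l -> V false i = Some (fb (z + r), i)) ->
  Z false = Some (fb z, l) -> block_covered l cv z r.
Proof.
move=> E EU EV EZ; split.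
- by move=> e; apply: (cov2_zigzag sx sy sd se l0 E) => //.
- apply: (@cov2_joins _ _ _ _ _ _ _ _ _ _ _ 0 l); rewrite ?add0n; try lia.
  by rewrite -EU // -EZ; exact: joins_UZ l0 E.
- apply: (@cov2_joins _ _ _ _ _ _ _ _ _ _ _ 0 l); rewrite ?add0n; try lia.
  by rewrite -EV // -EZ; exact: joins_VZ l0 E.
Qed.

(** The block (y, s) is assembled from three suns. The differences 0, ..., l - 1 come from the [U]
    side for z = y + r - s; the negative ones and the edge of difference l at y + s from the [V]
    side for z = y + s - r; the edge of difference l at y - s from the tip for z = y - s. The
    disjunction lets redirected [U] heads be replaced by other suns. *)
Lemma block_pendant r s : 0 < r <= q -> 0 < s <= q ->
    (forall z, z < w -> exists f HU, pt f = zigzag l (@gU q z r HU) (@gV l q z r s) (@gZ l q z s) /\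
      forall i, i < l -> HU i = @gHU q z r s i \/
        cv (fb (z + (w - r))) (fb (z + (w - r + 2 * s))) i) ->
  forall y, y < w -> block_covered l cv y s.
Proof.
move=> r0 s0 B y yw.
(* Solves z + b = y + a modulo w, with the three possible carries kept explicit for [lia]. *)
have sub a b : a <= q -> b <= q -> exists2 z, z < w &
    z + b = y + a + w \/ z + b = y + a \/ z + b + w = y + a.
  move=> aq bq; rewrite /w in yw *; case: (ltnP (y + a) b) => h1.
    by exists (y + a + w - b); rewrite /w; lia.
  case: (ltnP (y + a - b) w) => h2; first by exists (y + a - b); rewrite /w in h2 *; lia.
  by exists (y + a - b - w); rewrite /w in h2 *; lia.
have [rq sq] : r <= q /\ s <= q by lia.
have shift m n := @fiber_shift m n; rewrite /fb /w in shift yw *.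
split.
- move=> e [el|el].
    have [z zw Ez] := sub r s rq sq; have [f [HU [E HE]]] := B z zw; rewrite /w in zw Ez.
    have -> : fiber (2 * q) (y + ((2 * q).+1 - s)) = fb (z + (w - r)).
      by apply: shift; rewrite /w; lia.
    have -> : fiber (2 * q) (y + s) = fb (z + (w - r + 2 * s)).
      by apply: shift; rewrite /w; lia.
    case: (HE e el) => // Ee.
    apply: (@cov2_joins _ _ _ _ _ _ _ _ _ _ _ e (2 * e)); try lia.
    by have := joins_UU l0 E el; rewrite /gU Ee.
  have [z zw Ez] := sub s r sq rq; have [f [HU [E HE]]] := B z zw; rewrite /w in zw Ez.
  have -> : fiber (2 * q) (y + ((2 * q).+1 - s)) = fb (z + (r + 2 * w - 2 * s)).
    by apply: shift; rewrite /w; lia.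
  have -> : fiber (2 * q) (y + s) = fb (z + r) by apply: shift; rewrite /w; lia.
  have il : (2 * l).+1 - e < l by lia.
  apply: (@cov2_joins _ _ _ _ _ _ _ _ _ _ _ (2 * ((2 * l).+1 - e)) ((2 * l).+1 - e)); try lia.
  apply: joins_sym; have := joins_VV l0 E il; rewrite /gV.
  by case: eqP => [|_]; first lia.
- have [z zw Ez] := sub 0 s (leq0n _) sq; have [f [HU [E HE]]] := B z zw; rewrite /w in zw Ez.
  have -> : fiber (2 * q) (y + ((2 * q).+1 - s)) = fb (z + 0) by apply: shift; rewrite /w; lia.
  have -> : fiber (2 * q) y = fb (z + s) by apply: shift; rewrite /w; lia.
  apply: (@cov2_joins _ _ _ _ _ _ _ _ _ _ _ l (2 * l)); try lia.
  exact: (joins_ZZ l0 E).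
- have [z zw Ez] := sub s r sq rq; have [f [HU [E HE]]] := B z zw; rewrite /w in zw Ez.
  have -> : fiber (2 * q) (y + s) = fb (z + r) by apply: shift; rewrite /w; lia.
  have -> : fiber (2 * q) y = fb (z + (r + w - s)) by apply: shift; rewrite /w; lia.
  apply: (@cov2_joins _ _ _ _ _ _ _ _ _ _ _ 0 l); try lia.
  exact: (joins_VV l0 E l0).
Qed.

End GenericCover.

Lemma fiber_fiberD w' n c : fiber w' (fiber w' n + c) = fiber w' (n + c).
Proof. by apply: val_inj; rewrite /= !val_fiber modnDml. Qed.

(** * The case w = 4m + 1 *)

Section OneModFour.
Variables (l m : nat).
Let q := 2 * m.
Let w := (2 * q).+1.
Let h := l./2.
Let fb : nat -> 'I_w := fiber (2 * q).

(** In the pair (1, 2) the heads with i >= h are redirected to pure differences, and for odd l the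
    one with i = h goes to the fixed point. This releases l - h = h + [odd l] mixed differences for
    each z, exactly as many as there are pure differences still missing in each fibre. *)
Definition one4_U (z : nat) (j i : nat) : option ('I_w * nat) :=
  let r := 2 * j + 1 in let s := 2 * j + 2 in
  if (j == 0) && (h <= i) then
    if odd l && (i == h) then None else @pureU l q z r i
  else @gHU q z r s i.

Definition one4_sun (f : 'I_w * 'I_m) : bool -> nat -> option ('I_w * nat) :=
  let z := f.1 : nat in let r := 2 * f.2 + 1 in let s := 2 * f.2 + 2 in
  zigzag l (@gU q z r (one4_U z f.2)) (@gV l q z r s) (@gZ l q z s).

Let H : finType := ('I_w * 'I_(h + odd l))%type.

Lemma one4_system : prime (2 * l).+1 -> 0 < l -> 0 < m ->
  exists B : {set {set complete_graph ((2 * l).+1 * (2 * q).+1 + odd l)} *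
    {set {set complete_graph ((2 * l).+1 * (2 * q).+1 + odd l)}}},
  sun_system (2 * l).+1 B.
Proof.
move=> kp l0 m0.
have lE : odd l + h.*2 = l := odd_double_half l.
have wE : w = (4 * m).+1 by rewrite /w /q; lia.
have qE : q = 2 * m by [].
have fE (f : 'I_w * 'I_m) : f.2 < m by [].
have UE z j i : i < l ->
    [\/ one4_U z j i = @gHU q z (2 * j + 1) (2 * j + 2) i,
        one4_U z j i = @pureU l q z (2 * j + 1) i | one4_U z j i = None].
  by move=> _; rewrite /one4_U; case: ifP => _; [case: ifP => _|]; constructor.
have UN z j i : one4_U z j i = None -> odd l /\ i = h.
  by rewrite /one4_U; case: ifP => // _; case: andP => // -[? /eqP].
(* The released edges run from x = z - 1 to z - 1 + 2s = x + 4, with differences h, ..., l - 1,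
   which is the range of [a.2 + h]. The steps 2(l - [a.2]) are the pure differences that [pureU]
   does not reach. *)
apply: (@cyclic_fiber_system l (2 * q) ('I_w * 'I_m)%type H (odd l) one4_sun
  (fun a => a.1) (fun a => fb (a.1 + 4)) (fun a => 2 * (l - a.2)) (fun a => a.2 + h)) => //.
- move=> f b b' n n' nl nl'; apply: generic_sun_inj nl nl'; try by have := fE f; rewrite ?qE; lia.
    by move=> i; exact: UE.
  by move=> i j _ _ /UN [_ ->] /UN [_ ->].
- move=> f b n x p nl; rewrite /one4_sun => E; exact: (generic_sun_lt (UE f.1 f.2) nl E).
- by move=> f b n nl /generic_sun_None [i _ /UN []].
- move=> [x i] /=; have := ltn_ord i; split; try lia.
  rewrite -[x in x != _]fiberK -[X in fiber _ X]addn0; apply/eqP=> /fiber_addl /fiber_eq.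
  rewrite -/w; lia.
- move=> x i il; case: (ltnP i (h + odd l)) => ih.
    apply: (@cov2_pure l _ _ H one4_sun (fun a => a.1) (fun a => fb (a.1 + 4))
      (fun a => 2 * (l - a.2)) (fun a => a.2 + h) (x, Ordinal ih)) => /=; [by left | lia].
  apply: (@cov2_joins _ _ _ _ _ _ _ _ _ _ _ i (2 * l - i)); try lia.
  have := @joins_UU l _ _ one4_sun (fb (x + 1), Ordinal m0) _ _ _ l0 erefl i il.
  rewrite /gU /= /one4_U /=.
  have -> : h <= i by lia.
  case: ifP => [/andP [ol /eqP ?]|_]; first by rewrite ol in ih lE; lia.
  rewrite /pureU.
  suff -> : fiber (2 * q) (fb (x + 1) + ((2 * q).+1 - (2 * 0 + 1))) = x by [].
  rewrite /fb fiber_fiberD -[RHS]fiberK; apply: fiber_shift; lia.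
- apply: cov_mix_blocks => z R zw R0.
  have [[j Rj]|[j Rj]] : (exists j, R = 2 * j + 1) \/ (exists j, R = 2 * j + 2).
    have := odd_double_half R.-1; case: (odd _) => /= E; [right | left];
      by exists (R.-1)./2; lia.
    have jm : j < m by lia.
    rewrite Rj; apply: (@block_cycle _ _ _ _ one4_sun _ _ _ _ l0 (Ordinal zw, Ordinal jm)).
    + by [].
    + by [].
    + by [].
    + by rewrite /gZ addn0.
  have jm : j < m by lia.
  rewrite Rj; apply: (@block_pendant _ _ _ _ _ _ _ _ _ l0 (2 * j + 1)) => //; try lia.
  move=> {}z {}zw; exists (Ordinal zw, Ordinal jm); exists (one4_U z j); split=> // i il.
  rewrite /one4_U; case: ifP => [/andP [/eqP j0 hi]|_]; last by left.
  right; have ih : i - h < h + odd l by lia.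
  have := @cov2_pendant l _ _ H one4_sun (fun a => a.1) (fun a => fb (a.1 + 4))
    (fun a => 2 * (l - a.2))    (fun a => a.2 + h) (fb (z + (w - 1)), Ordinal ih).
  by rewrite /= /fb fiber_fiberD subnK // j0 -addnA.
- move=> ol x; exists h; split; first lia.
  apply: joins_sym.
  have := @joins_UU l _ _ one4_sun (fb (x + 1), Ordinal m0) _ _ _ l0 erefl h _.
  rewrite /gU /= /one4_U /= leqnn eqxx ol /=.
  have -> : fiber (2 * q) (fb (x + 1) + ((2 * q).+1 - (2 * 0 + 1))) = x.
    rewrite /fb fiber_fiberD -[RHS]fiberK; apply: fiber_shift; lia.
  by apply; lia.
- rewrite !card_prod !card_ord wE qE; move: lE; rewrite -/h.
  move: h (odd l) => g b <-; case: b.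
    rewrite addnK.
    have -> : (2 * (true + g.*2)).+1 * (2 * (2 * m)).+1 + true =
      4 * ((2 * (true + g.*2)).+1 * m + (g + true)) by rewrite -mul2n /=; lia.
    by rewrite -mul2n /=; ring.
  have -> : (2 * (false + g.*2)).+1 * (2 * (2 * m)).+1 + false - 1 =
    4 * ((2 * (false + g.*2)).+1 * m + (g + false)) by rewrite -mul2n /=; lia.
  by rewrite -mul2n /=; ring.
Qed.

End OneModFour.

(** * Three fibres without a fixed point *)

Lemma fiber_pt_inj w' (m n p p' : nat) :
  Some (fiber w' m, p) = Some (fiber w' n, p') ->
  m < w'.+1 -> n < w'.+1 -> m = n /\ p = p'.
Proof. by move=> [E ->] mw nw; rewrite (fiber_inj mw nw E). Qed.

Lemma cov_mix3 l (L H : finType) (pt : L -> bool -> nat -> option ('I_3 * nat))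
    (sx sy : H -> 'I_3) (sd se : H -> nat) (k := (2 * l).+1)
    (cv := cov2 k (2 * l) pt sx sy sd se) :
  (forall e, e < k -> cv (fiber 2 0) (fiber 2 1) e) ->
  (forall e, e < k -> cv (fiber 2 0) (fiber 2 2) e) ->
  (forall e, e < k -> cv (fiber 2 1) (fiber 2 2) e) ->
  forall x y e, x != y -> e < k -> cv x y e.
Proof.
move=> c01 c02 c12 x y e + ek.
have S x' y' : (forall e, e < k -> cv x' y' e) -> cv y' x' e.
  move=> C; case: (eqVneq e 0) => e0; first by apply: cov2_sym (C 0 _); lia.
  by apply: cov2_sym (C (k - e) _); lia.
rewrite -(fiberK x) -(fiberK y); have := ltn_ord x; have := ltn_ord y.
case: (x : nat) => [|[|[|?]]] //; case: (y : nat) => [|[|[|?]]] // _ _;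
  rewrite ?eqxx //; auto.
Qed.

Section ThreeFibers.
Variable (l : nat).
Let fb : nat -> 'I_3 := fiber 2.
Let h := (l + 1)./2.
Let k := (2 * l).+1.

(** The heads used for larger w = 4m + 3 collide here: for m = 0, [odd_h0] and [odd_h1] would both
    reach position 2i of fibre 2. The heads of this sun give instead l from 0 to 1, 0, ..., h - 2
    from 0 to 2, 0, ..., l - 1 from 1 to 2, l from 2 to 0, and pure differences in fibre 0 from i =
    h on. *)
Definition three_U (b : bool) i :=
  if b then if i == 0 then Some (fb 1, l)
            else if i < h then Some (fb 2, 2 * i - 1) else Some (fb 0, 2 * l - i)
  else Some (fb 0, i).
Definition three_V (b : bool) i := if b then Some (fb 2, 2 * i) else Some (fb 1, i).
Definition three_Z (b : bool) := if b then Some (fb 0, 2 * l) else Some (fb 2, l).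
Definition three_sun (f : unit) := zigzag l three_U three_V three_Z.

Let H : finType := ('I_l + 'I_h + 'I_l)%type.
(** The pendant differences are those that [three_sun] leaves open: l + 1, ..., 2l from 1 to 2; l +
    1 from 0 to 1; and, from 0 to 2, h - 1, ..., l - 1 together with -i for 0 < i < l. Those
    starting at fibre 2 are read backwards. *)
Definition three_short (a : H) : 'I_3 * nat * ('I_3 * nat) :=
  match a with
  | inl (inl i) => (fb 1, 2 * (l - i), (fb 2, 2 * l - i))
  | inl (inr i) => (fb 0, 2 * (l - i), if i == 0 :> nat then (fb 1, l.+1) else (fb 2, k - i))
  | inr i => (fb 2, 2 * (l - i),
     (fb 0, if i < h then if h - 1 + i == 0 then 0 else k - (h - 1 + i) else (i : nat)))
  end.

Lemma three_system : prime k -> odd l ->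
  exists B : {set {set complete_graph (k * 3 + false)} *
    {set {set complete_graph (k * 3 + false)}}}, sun_system k B.
Proof.
move=> kp ol.
have lE : l = (2 * h).-1.
  by have := odd_double_half (l + 1); rewrite oddD ol /= -/h; lia.
have h0 : 0 < h by rewrite lt0n; apply: contraTneq ol => h0; rewrite lE h0.
have l0 : 0 < l by lia.
pose sx a := (three_short a).1.1; pose sd a := (three_short a).1.2.
pose sy a := (three_short a).2.1; pose se a := (three_short a).2.2.
have J := @cov2_joins l _ _ _ three_sun sx sy sd se.
have UU i := @joins_UU l _ _ three_sun tt _ _ _ l0 erefl i.
have VV i := @joins_VV l _ _ three_sun tt _ _ _ l0 erefl i.
have S a := @cov2_pendant l _ _ H three_sun sx sy sd se a.
have D a := @cov2_pure l _ _ H three_sun sx sy sd se a.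
apply: (@cyclic_fiber_system l 2 unit H false three_sun sx sy sd se) => //.
- move=> [] b b' n n'; apply: zigzag_inj => {b b' n n'}.
  + move=> b b' i j il jl; rewrite /three_U; case: b b' => [] []; do ?case: ifP => ?;
    move/fiber_pt_inj; lia.
  + move=> b b' i j il jl; rewrite /three_V; case: b b' => [] []; do ?case: ifP => ?;
    move/fiber_pt_inj; lia.
  + move/fiber_pt_inj; lia.
  + move=> b b' i j il jl; rewrite /three_V /three_U; case: b b' => [] []; do ?case: ifP => ?;
    move/fiber_pt_inj; lia.
  + move=> b b' i il; rewrite /three_Z /three_U; case: b b' => [] []; do ?case: ifP => ?;
    move/fiber_pt_inj; lia.
  + move=> b b' i il; rewrite /three_Z /three_V; case: b b' => [] []; do ?case: ifP => ?;
    move/fiber_pt_inj; lia.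
- move=> [] b n x p nk; rewrite /three_sun /zigzag /three_U /three_V /three_Z.
  have := odd_double_half n; move: (n./2) => a.
  case: b; do ?case: ifP => ?; case: (odd n) => /= En; case=> _ <-; lia.
- by move=> [] b n nk; rewrite /three_sun /zigzag /three_U /three_V /three_Z; case: b;
    do ?case: ifP => ?.
- move=> [[i|i]|i]; rewrite /sx /sy /sd /se /=; have il := ltn_ord i; split;
    do ?case: ifP => ?; rewrite /= ?/k; try lia; apply/eqP => /fiber_inj; lia.
- move=> x i il; rewrite -(fiberK x); have := ltn_ord x.
  case: (x : nat) => [|[|[|?]]] // _ {x}.
  + case: (ltnP i h) => ih; first by apply: (D (inl (inr (Ordinal ih)))) => /=; [left | lia].
    apply: (J _ _ i (2 * l - i)); try lia.
    have := UU i il; rewrite /=; case: eqP => [|_]; first lia.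
    by rewrite ltnNge ih.
  + by apply: (D (inl (inl (Ordinal il)))) => /=; [left | lia].
  + by apply: (D (inr (Ordinal il))) => /=; [left | lia].
- apply: cov_mix3 => e ek.
  + have [|[->|->]] : (e < l \/ l.+1 < e < (2 * l).+1) \/ e = l \/ e = l.+1.
      by rewrite /k in ek; lia.
    * exact: (cov2_zigzag sx sy sd se l0 (pt := three_sun) (f := tt) erefl).
    * by apply: (J _ _ 0 l); try lia; exact: (UU 0 l0).
    * exact: (S (inl (inr (Ordinal h0)))).
  + case: (eqVneq e l) => [->|el].
      apply: (J _ _ 0 l); try lia.
      exact: (@joins_UZ l _ _ three_sun tt _ _ _ l0 erefl).
    case: (ltnP e l) => el'.
      case: (ltnP e (h - 1)) => eh.
        apply: (J _ _ e.+1 (2 * e.+1 - 1)); try lia.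
        have el1 : e.+1 < l by lia.
        have := UU e.+1 el1; rewrite /=.
        by have -> : e.+1 < h by lia.
      have il : e - (h - 1) < l by lia.
      have := S (inr (Ordinal il)); rewrite /sx /sy /se /=.
      have -> : e - (h - 1) < h by lia.
      rewrite subnKC //; apply: cov2_sym; do ?case: eqP => ?; rewrite ?/k; lia.
    have [t Et] : exists t, e + t = k by exists (k - e); lia.
    have e_ : e = k - t by lia.
    rewrite e_ /k in el el' Et *.
    case: (ltnP t h) => th.
      have := S (inl (inr (Ordinal th))); rewrite /sx /sy /se /=.
      by case: eqP => [t0|_ //]; lia.
    case: (ltnP t l) => tl.
      have := S (inr (Ordinal tl)); rewrite /sx /sy /se /= ltnNge th /=.
      by apply: cov2_sym; lia.
    have -> : t = l by lia.
    apply: (@cov2_sym _ _ _ _ _ _ _ _ _ _ _ l); try lia.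
    apply: (J _ _ l (2 * l)); try lia.
    exact: (@joins_ZZ l _ _ three_sun tt _ _ _ l0 erefl).
  + case: (eqVneq e l) => [->|el].
      apply: (J _ _ 0 l); try lia.
      exact: (@joins_VZ l _ _ three_sun tt _ _ _ l0 erefl).
    case: (ltnP e l) => el'.
      by apply: (J _ _ e (2 * e)); try lia; exact: (VV e el').
    have il : 2 * l - e < l by rewrite /k in ek; lia.
    have := S (inl (inl (Ordinal il))); rewrite /sx /sy /se /=.
    by have -> : 2 * l - (2 * l - e) = e by rewrite /k in ek; lia.
- rewrite !card_sum !card_ord card_unit /k lE addn0.
  have [g ->] : exists g, h = g.+1 by exists h.-1; lia.
  have -> : (2 * (2 * g.+1).-1).+1 * 3 - 1 = 4 * (3 * g + 2) by lia.
  have -> : (2 * g.+1).-1 = (2 * g).+1 by lia.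
  by ring.
Qed.

End ThreeFibers.

(** * Three fibres with a fixed point *)

Section ThreeFibersPlus.
Variable (h : nat).
Let l := 2 * h.
Let fb : nat -> 'I_3 := fiber 2.
Let k := (2 * l).+1.

(** The sun [false] has the fixed point as [Z], whose three edges reach all three fibres. The cycle
    of the sun [true] leaves fibre 0 for fibre 1 while the differences are nonnegative, and for
    fibre 2 once they are negative; this is the test i < h in [three1_V]. In fibre 2 the pure
    differences appear as their odd representatives 2l - 1 - 2i. *)
Definition three1_U (f b : bool) i :=
  if f then
    if b then if i == 0 then Some (fb 2, l)
              else if odd i then Some (fb 1, i./2 + 3 * h + 1) else Some (fb 0, 2 * l - i)
    else Some (fb 0, i)
  else
    if b then if i < h then Some (fb 1, 2 * l - i) else Some (fb 0, 2 * i + 1 - h)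
    else Some (fb 1, i).
Definition three1_V (f b : bool) i :=
  if f then
    if i < h then Some (fb 2, if b then 2 * l - 1 - i else i)
    else Some (fb 1, if b then 2 * l - i else i)
  else
    if b then if i < h then Some (fb 0, if 2 * i + 1 < h then 2 * i + 1 + k - h else 2 * i + 1 - h)
              else Some (fb 2, 2 * l - 1 - i)
    else Some (fb 2, i).
Definition three1_Z (f b : bool) :=
  if f then if b then Some (fb 2, 2 * l) else Some (fb 1, l)
  (* For an edge at the fixed point any position will do; 3h is one that the other heads of this sun
     in fibre 0 leave free. *)
  else if b then Some (fb 0, 3 * h) else None.
Definition three1_sun (f : bool) := zigzag l (three1_U f) (three1_V f) (three1_Z f).

(** Of the pure differences 2(l - i) in fibre 0, the sun [true] supplies those with i even and
    positive. Odd i and i = 0, the last element, remain, and the pendant edges fill h, ..., l - 1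
    and l + 1 from fibre 0 to fibre 2. *)
Definition three1_d (i : 'I_h.+1) := if i < h then 2 * (l - (2 * i + 1)) else 2 * l.
Definition three1_e (i : 'I_h.+1) := if i < h then h + i else l.+1.

Lemma three1_system : prime k -> 0 < h ->
  exists B : {set {set complete_graph (k * 3 + true)} *
    {set {set complete_graph (k * 3 + true)}}}, sun_system k B.
Proof.
move=> kp h0.
have l0 : 0 < l by rewrite /l; lia.
pose sx (_ : 'I_h.+1) := fb 0; pose sy (_ : 'I_h.+1) := fb 2.
have J := @cov2_joins l _ _ _ three1_sun sx sy three1_d three1_e.
have UU f i := @joins_UU l _ _ three1_sun f _ _ _ l0 erefl i.
have VV f i := @joins_VV l _ _ three1_sun f _ _ _ l0 erefl i.
have ZZ f := @joins_ZZ l _ _ three1_sun f _ _ _ l0 erefl.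
have UZ f := @joins_UZ l _ _ three1_sun f _ _ _ l0 erefl.
have VZ f := @joins_VZ l _ _ three1_sun f _ _ _ l0 erefl.
have UV f i j := @joins_UV l _ _ three1_sun f _ _ _ l0 erefl i j.
have S a := @cov2_pendant l _ _ _ three1_sun sx sy three1_d three1_e a.
have D a := @cov2_pure l _ _ _ three1_sun sx sy three1_d three1_e a.
apply: (@cyclic_fiber_system l 2 bool _ true three1_sun sx sy three1_d three1_e) => //.
- move=> f b b' n n'; apply: zigzag_inj => {b b' n n'}.
  + move=> b b' i j il jl; have := odd_double_half i; have := odd_double_half j.
    rewrite /three1_U; case: f; case: b b' => [] []; do ?[case: ifP => ?] => E1 E2;
    move/fiber_pt_inj; rewrite /l in il jl *; lia.
  + move=> b b' i j il jl; rewrite /three1_V; case: f; case: b b' => [] []; do ?case: ifP => ?;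
    move/fiber_pt_inj; rewrite /k /l in il jl *; lia.
  + by rewrite /three1_Z; case: f => //; move/fiber_pt_inj; lia.
  + move=> b b' i j il jl; have := odd_double_half i;
    rewrite /three1_V /three1_U; case: f; case: b b' => [] []; do ?[case: ifP => ?] => E1;
    move/fiber_pt_inj; rewrite /k /l in il jl *; lia.
  + move=> b b' i il; have := odd_double_half i;
    rewrite /three1_Z /three1_U; case: f; case: b b' => [] []; do ?[case: ifP => ?] => E1 //;
    move/fiber_pt_inj; rewrite /k /l in il *; lia.
  + move=> b b' i il; rewrite /three1_Z /three1_V; case: f; case: b b' => [] []; do ?case: ifP => ?;
    try (by []);
    move/fiber_pt_inj; rewrite /k /l in il *; lia.
- move=> f b n x p nk; rewrite /three1_sun /zigzag /three1_U /three1_V /three1_Z.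
  have := odd_double_half n; move: (n./2) => a.
  have := odd_double_half a => Ea.
  case: (odd n) => /= En; case: f; case: b; do ?case: ifP => ?; try by [];
    case=> _ <-; rewrite /k /l in nk *; lia.
- move=> i; rewrite /sx /sy /three1_d /three1_e; have il := ltn_ord i; split; do ?case: ifP => ?;
  rewrite /k /l; try lia; apply/eqP => /fiber_inj; lia.
- move=> x i il; rewrite -(fiberK x); have := ltn_ord x.
  case: (x : nat) => [|[|[|?]]] // _ {x}.
  + have := odd_double_half i; case Oi: (odd i) => /= Ei.
      have ih : i./2 < h by rewrite /l in il; lia.
      apply: (D (Ordinal (ltnW ih : i./2 < h.+1))); rewrite /three1_d /= ?ih /l /k; lia.
    case: (eqVneq i 0) => i0.
      apply: (D (Ordinal (ltnSn h))); rewrite /three1_d /= ?ltnn /l /k; lia.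
    apply: (J _ _ i (2 * l - i)); try lia.
    by have := UU true i il; rewrite /= Oi (negbTE i0).
  + case: (ltnP i h) => ih; apply: (J _ _ i (2 * l - i)); try lia.
      by have := UU false i il; rewrite /= ih.
    by have := VV true i il; rewrite /= /three1_V ltnNge ih.
  + apply: (@cov2_sym _ _ _ _ _ _ _ _ _ _ _ (2 * l - 1 - 2 * (l - 1 - i))); try lia.
    have i'l : l - 1 - i < l by lia.
    apply: (J _ _ (l - 1 - i) (2 * l - 1 - (l - 1 - i))); try lia.
    case: (ltnP (l - 1 - i) h) => ih.
      by have := VV true _ i'l; rewrite /= /three1_V ih.
    by have := VV false _ i'l; rewrite /= ltnNge ih.
- have V1 b j : h <= j -> three1_V true b j = Some (fb 1, if b then 2 * l - j else j).
    by rewrite /three1_V ltnNge => ->.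
  have V2 b j : j < h -> three1_V true b j = Some (fb 2, if b then 2 * l - 1 - j else j).
    by rewrite /three1_V => ->.
  apply: cov_mix3 => e ek; rewrite -/k in ek.
  + case: (ltnP e l) => el.
      have [a [ae ah al]] : exists a,
          [/\ a + (a + e) = l - 1 \/ a + (a + e) = l, h <= a + e & a + e < l].
        have := odd_double_half (l - e); case: (odd _) => /= E; exists (l - e)./2;
        rewrite /l in el E ek *; split; lia.
      apply: (J _ _ a (a + e)); try lia.
      by have := UV true a (a + e); rewrite V1 //; apply; lia.
    case: (eqVneq e l) => [->|el'].
      by apply: (J _ _ 0 l); try lia; exact: (UZ true).
    have [t Et] : exists t, t + e = k by exists (k - e); lia.
    apply: (@cov2_sym _ _ _ _ _ _ _ _ _ _ _ t); try (by rewrite /k in Et ek; lia).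
    case: (leqP t h) => th.
      apply: (J _ _ (t + h - 1) (2 * (t + h - 1) + 1 - h)); try (rewrite /k /l in Et el *; lia).
      have := UU false (t + h - 1); rewrite /=.
      have -> : (t + h - 1 < h) = false by rewrite /k /l in Et ek; lia.
      apply; rewrite /k /l in Et el *; lia.
    apply: (J _ _ (t - h - 1 + 3 * h + 1) (2 * (t - h - 1) + 1));
      try (rewrite /k /l in Et el *; lia).
    apply: joins_sym; have := UU true (2 * (t - h - 1) + 1); rewrite /=.
    rewrite addn1 /= mul2n odd_double /= uphalf_double addn1.
    apply; rewrite /k /l in Et el el' *; lia.
  + case: (ltnP e h) => eh.
      pose i := h - 1 - e.
      apply: (@cov2_sym _ _ _ _ _ _ _ _ _ _ _ ((k - e) %% k)); rewrite ?ltn_pmod //.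
        case: (posnP e) => [->|e0]; first by rewrite subn0 modnn; left.
        by right; rewrite modn_small; lia.
      have il : i < l by rewrite /i /l; lia.
      apply: (J _ _ i (if 2 * i + 1 < h then 2 * i + 1 + k - h else 2 * i + 1 - h)).
      * by lia.
      * by case: ifP => ?; rewrite /i /k /l in il *; lia.
      * case: (posnP e) => [e0|e0]; first rewrite e0 subn0 modnn.
          by case: ifP => ?; rewrite /i /k /l in il *; lia.
        by rewrite modn_small; [case: ifP => ?; rewrite /i /k /l in il *; lia | lia].
      * have := VV false i il; rewrite /=.
        by have -> : i < h by rewrite /i; lia.
    case: (ltnP e l) => el.
      have ih : e - h < h.+1 by rewrite /l in el; lia.
      have := S (Ordinal ih); rewrite /sx /sy /three1_e /=.
      have -> : e - h < h by rewrite /l in el; lia.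
      by rewrite subnKC.
    case: (eqVneq e l) => [->|el'].
      by apply: (J _ _ 0 l); try lia; exact: (UU true 0 l0).
    case: (eqVneq e l.+1) => [->|el2].
      by have := S (Ordinal (ltnSn h)); rewrite /sx /sy /three1_e /= ltnn.
    have [t Et] : exists t, t + e = k by exists (k - e); lia.
    have [a [ae ah al]] : exists a, [/\ (a + t) + a = l - 1 \/ (a + t) + a = l, a < h & a + t < l].
      have := odd_double_half (l - t); case: (odd _) => /= E; exists (l - t)./2;
      rewrite /k /l in el el' el2 Et E ek *; split; lia.
    apply: (J _ _ (a + t) a); try lia.
    by have := UV true (a + t) a; rewrite V2 //; apply; lia.
  + have [|[->|->]] : (e < l \/ l.+1 < e < (2 * l).+1) \/ e = l \/ e = l.+1.
      by rewrite /k in ek; lia.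
    * apply: (cov2_zigzag sx sy three1_d three1_e l0 (pt := three1_sun) (f := false) erefl) => //.
    * by apply: (J _ _ l (2 * l)); try lia; exact: (ZZ true).
    * apply: (@cov2_sym _ _ _ _ _ _ _ _ _ _ _ l); try lia.
      apply: (J _ _ 0 l); try lia.
      by have := VZ true; rewrite V2.
- move=> _ x; rewrite -(fiberK x); have := ltn_ord x.
  case: (x : nat) => [|[|[|?]]] // _ {x}.
  + by exists (3 * h); rewrite /l; split; [lia | exact: (ZZ false)].
  + by exists 0; split=> //; apply: joins_sym; exact: (UZ false).
  + by exists 0; split=> //; apply: joins_sym; exact: (VZ false).
- rewrite card_ord card_bool /k /l addnK.
  have -> : (2 * (2 * h)).+1 * 3 + true = 4 * (3 * h + 1) by rewrite /=; lia.
  by ring.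
Qed.

End ThreeFibersPlus.

(** * A single cyclic orbit of vertices: v or v - 1 divisible by 4p *)

Lemma unit_pt_inj (p p' : nat) : Some (tt, p) = Some (tt, p') -> p = p'.
Proof. by case. Qed.

Section OneOrbit.
Variables (l m : nat) (o : bool).
Let k := (2 * l).+1.
Let S := 2 * (l * m) + m.

(* Up to a permutation of the suns inside the blocks a < 2 and a = 2l, the
   differences in sun j are a * m + j, one for each a < 4l + 2; the last one is
   absent when the fixed point is present. *)
Definition orbit_U (j : nat) b i : option (unit * nat) :=
  if i == 0 then Some (tt, if b then S + 3 * (l * m) + m + j else S)
  else Some (tt, if b then S + 3 * (l * m) + 2 * j - 1 - m - 2 * (i * m)
                 else S + j - 1 - m - i * m).
Definition orbit_W (j : nat) b i : option (unit * nat) :=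
  if b then if [&& o, i.+1 == l & j == m] then None
            else Some (tt, S + 3 * (l * m) + 2 * m + 2 * (i * m) + 3 * j - 1)
  else Some (tt, S + 2 * j - 1 + i * m).
Definition orbit_Z (j : nat) b : option (unit * nat) :=
  Some (tt, if b then 3 * j - 1 else j - 1).
Definition orbit_sun (f : 'I_m) :=
  zigzag l (orbit_U f.+1) (fun b a => orbit_W f.+1 b (l - 1 - a)) (orbit_Z f.+1).

Lemma one_orbit_system : 0 < l -> 0 < m ->
  exists B : {set {set complete_graph (4 * k * m + (~~ o))} *
    {set {set complete_graph (4 * k * m + (~~ o))}}}, sun_system k B.
Proof.
move=> l0 m0.
(* The group has order 4km + 1, or 4km - 1 beside a fixed point. Up to sign there are 2km - o
   nonzero differences for the 2km edges of the m base suns, so with a fixed point one edge is left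
   over to reach it. *)
pose N' := 4 * k * m - 2 * o.
have NE : N'.+1 + 2 * o = 8 * (l * m) + 4 * m + 1.
  rewrite /N' /k; have : 0 < l * m by rewrite muln_gt0 l0.
  have -> : 4 * (2 * l).+1 * m = 8 * (l * m) + 4 * m by ring.
  case: (o); lia.
have o1 : o <= 1 by case: (o).
have mul a b : a < b -> a * m + m <= b * m by move=> ab; rewrite addnC -mulSn leq_mul2r ab orbT.
have pos a : a <> 0 -> m <= a * m.
  by move/eqP; rewrite -lt0n => /mul; rewrite mul0n.
have inj a b : a * m = b * m -> a = b by move/eqP; rewrite eqn_pmul2r // => /eqP.
have -> : 4 * k * m + ~~ o = N'.+1 * #|{: unit}| + o.
  by rewrite card_unit /N' /k; case: (o) => /=; nia.
apply: (@development_system k N' unit 'I_m void o orbit_sun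
  (fun=> tt) (fun=> tt) (fun=> 0) (fun=> 0)) => //.
- by rewrite /k; lia.
- move=> f b b' n n'; have fm := ltn_ord f.
  have lm1 := mul _ _ l0; rewrite mul0n in lm1.
  apply: zigzag_inj => {b b' n n'}.
  + move=> b b' i j il jl; have M1 := mul _ _ il; have M2 := mul _ _ jl.
    have ji := @inj i j.
    have I1 := pos i; have I2 := pos j.
    by rewrite /orbit_U; do 2?case: eqP => ?;
      case: b b' => [] [] /unit_pt_inj; rewrite /S; lia.
  + move=> b b' a c al cl; have := @inj (l - 1 - a) (l - 1 - c).
    have := mul (l - 1 - a) l; have := mul (l - 1 - c) l.
    have : l - 1 - a < l by lia.
    have : l - 1 - c < l by lia.
    have : l - 1 - a = l - 1 - c -> a = c by lia.
    move: (l - 1 - a) (l - 1 - c) => i j ac jl il M1 M2 ij.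
    rewrite /orbit_W; case: b b' => [] []; do ?case: and3P => [[_ /eqP ? /eqP ?]|?]; try by [].
    * by move=> _; split=> //; apply: ac; lia.
    * move/unit_pt_inj; rewrite /S; lia.
    * move/unit_pt_inj; rewrite /S; lia.
    * move/unit_pt_inj; rewrite /S; lia.
    * move/unit_pt_inj; rewrite /S; lia.
  + by move/unit_pt_inj; lia.
  + move=> b b' i a il al; have := mul (l - 1 - a) l.
    have : l - 1 - a < l by lia.
    move: (l - 1 - a) => j jl M2; have M1 := mul _ _ il.
    have I1 := pos i; rewrite /orbit_U /orbit_W; case: (i =P 0) => ?;
      case: b b' => [] []; do ?case: and3P => [?|?]; try by [];
      move/unit_pt_inj; rewrite /S; lia.
  + move=> b b' i il; have M1 := mul _ _ il.
    have I1 := pos i; rewrite /orbit_U /orbit_Z; case: eqP => ?;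
      case: b b' => [] [] /unit_pt_inj; rewrite /S; lia.
  + move=> b b' a al; rewrite /orbit_W /orbit_Z; move: (l - 1 - a) => c.
    case: b b' => [] []; do ?case: and3P => [?|?]; try by []; move/unit_pt_inj; rewrite /S; lia.
- move=> f b n x p nk; rewrite /orbit_sun /zigzag; have fm := ltn_ord f.
  have := odd_double_half n; move: (n./2) => a.
  have lm1 := mul _ _ l0; rewrite mul0n in lm1.
  case: eqP => [_ _|nl]; first by case: b => -[_ <-]; lia.
  case: (odd n) => /= En.
    have := mul (l - 1 - (l - 1 - a)) l.
    have -> : l - 1 - (l - 1 - a) = a by rewrite /k in nk; lia.
    have al : a < l by rewrite /k in nk; lia.
    move=> /(_ al) M1; rewrite /orbit_W; case: b; do ?case: and3P => [?|?]; try by [];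
      case=> _ <-; rewrite /S; lia.
  have al : a < l by rewrite /k in nk; lia.
  have M1 := mul _ _ al.
  have I1 := pos a; rewrite /orbit_U; case: eqP => ?; case: b; case=> _ <-; rewrite /S; lia.
- move=> f b n nk; rewrite /orbit_sun /zigzag /orbit_Z /orbit_U /orbit_W.
  by case: b; do ?[case: ifP => [/and3P [] //|]|case: ifP => //] => _.
- have EU j b i : i <> 0 -> orbit_U j b i =
      Some (tt, if b then S + 3 * (l * m) + 2 * j - 1 - m - 2 * (i * m)
                else S + j - 1 - m - i * m) by move/eqP=> i0; rewrite /orbit_U (negbTE i0).
  have UU f i := @joins_UU l _ _ orbit_sun f _ _ _ l0 erefl i.
  have VV (f : 'I_m) i : i < l -> joins k orbit_sun (orbit_W f.+1 false i) (orbit_W f.+1 true i).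
    move=> il; have := @joins_VV l _ _ orbit_sun f _ _ _ l0 erefl (l - 1 - i).
    have -> : l - 1 - (l - 1 - i) = i by lia.
    by apply; lia.
  have ZZ f := @joins_ZZ l _ _ orbit_sun f _ _ _ l0 erefl.
  have UZ f := @joins_UZ l _ _ orbit_sun f _ _ _ l0 erefl.
  have VZ f := @joins_VZ l _ _ orbit_sun f _ _ _ l0 erefl.
  rewrite subn0 in VZ.
  have UV (f : 'I_m) i j : i < l -> j < l -> i = j \/ i = j.+1 ->
      joins k orbit_sun (orbit_U f.+1 false i) (orbit_W f.+1 false j).
    move=> il jl ij; have := @joins_UV l _ _ orbit_sun f _ _ _ l0 erefl i (l - 1 - j).
    have -> : l - 1 - (l - 1 - j) = j by lia.
    by apply; lia.
  have JE p q p' q' : joins k orbit_sun (Some (tt, p)) (Some (tt, q)) -> p = p' -> q = q' ->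
      joins k orbit_sun (Some (tt, p')) (Some (tt, q')) by move=> J <- <-.
  (* Half of the group suffices, since d and N - d are the same difference up to sign. *)
  suff K d : 0 < d <= 4 * (l * m) + 2 * m - o ->
      exists2 p, p + d < N'.+1 & joins k orbit_sun (Some (tt, p)) (Some (tt, p + d)).
    move=> [] d d0; case: (leqP d (4 * (l * m) + 2 * m - o)) => dle.
      have [|p pd J] := K d; first lia.
      by left; left; exists p, (p + d); split=> //; [lia | left].
    have [|p pd J] := K (N'.+1 - d); first lia.
    left; left; exists (p + (N'.+1 - d)), p; split=> //; [lia | right; lia |].
    exact: joins_sym.
  move=> d0.
  have [a [j [j0 jm dE]]] : exists a j, [/\ 0 < j, j <= m & d = a * m + j].
    exists (d.-1 %/ m), (d.-1 %% m).+1; split=> //; first by rewrite ltn_pmod.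
    by rewrite addnS -divn_eq; lia.
  have FJ c : 0 < c -> c <= m -> exists f : 'I_m, f.+1 = c.
    by case: c => // c _ cm; exists (Ordinal cm).
  have [f fj] := FJ j j0 jm.
  have al : a < 4 * l + 2.
    rewrite ltnNge; apply/negP => /(leq_mul (leqnn m)) h1.
    have : m * (4 * l + 2) = 4 * (l * m) + 2 * m by ring.
    by rewrite mulnC in h1; rewrite mulnC (mulnC m) in h1 *; lia.
  have lm1 : m <= l * m by apply: pos; lia.
  rewrite /S in EU.
  (* The differences 1, ..., 2m are split by parity: 2j - 1 is the cycle edge between [U 0] and the
     first [orbit_W], and 2j is the pendant edge at [Z]. *)
  case: (ltnP a 2) => a2.
    have d2 : d <= 2 * m by case: a a2 dE {al} => [|[|?]] // _; lia.
    have := odd_double_half d; case: (odd d) => /= dd.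
      have [||g gj] := FJ d./2.+1; try lia.
      exists S; first by rewrite /S; lia.
      apply: JE (UV g 0 0 l0 l0 _) _ _; rewrite ?gj /S; lia.
    have [||g gj] := FJ d./2; try lia.
    exists (d./2 - 1); first by lia.
    apply: JE (ZZ g) _ _; rewrite ?gj; lia.
  case: (ltnP a (2 * l)) => a2l.
    have := odd_double_half a; case: (odd a) => /= aE.
      have i0 : a./2 <> 0 by lia.
      have il : a./2 < l by lia.
      have M := mul _ _ il.
      have dE' : d = 2 * (a./2 * m) + m + j by rewrite dE -{1}aE -mul2n; ring.
      exists (S + j - 1 - m - a./2 * m); first by rewrite /S; lia.
      have := UV f (a./2) (a./2) il il (or_introl erefl); rewrite EU // fj.
      by move=> J; apply: JE J _ _; rewrite /S; lia.
    have i0 : a./2 <> 0 by lia.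
    have il : a./2 < l by lia.
    have M := mul _ _ il.
    have dE' : d = 2 * (a./2 * m) + j by rewrite dE -{1}aE -mul2n; ring.
    have M' : a./2 * m = (a./2).-1 * m + m by case: (a./2) i0 => // c _; rewrite mulSn addnC.
    exists (S + j - 1 - m - a./2 * m); first by rewrite /S; lia.
    have := UV f (a./2) (a./2).-1 il; rewrite EU // fj /orbit_W => J.
    by apply: JE (J _ _) _ _; rewrite /S; lia.
  case: (ltnP (2 * l) a) => a2l'; last first.
    have aE : a = 2 * l by lia.
    have dE' : d = 2 * (l * m) + j by rewrite dE aE; ring.
    (* The edge from [Z] to [U 0] in sun j' has difference 2lm + m + 1 - j', so this block runs
       through the suns in reverse order. *)
    have [||g gj] := FJ (m + 1 - j); try lia.
    exists (m - j); first by lia.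
    apply: joins_sym; apply: JE (UZ g) _ _; rewrite ?gj /S; lia.
  case: (ltnP a (3 * l)) => a3l.
    have [i iE] : exists i, a + i = 3 * l by exists (3 * l - a); lia.
    have i0 : i <> 0 by lia.
    have il : i < l by lia.
    have M := mul _ _ il; have M' := pos _ i0.
    have dE' : d + i * m = 3 * (l * m) + j.
      have E : (a + i) * m = 3 * (l * m) by rewrite iE; ring.
      by rewrite -E dE; ring.
    exists (S + j - 1 - m - i * m); first by rewrite /S; lia.
    have := UU f i il; rewrite !EU // fj.
    by move=> J; apply: JE J _ _; rewrite /S; lia.
  case: (ltnP (3 * l) a) => a3l'; last first.
    have aE : a = 3 * l by lia.
    have dE' : d = 3 * (l * m) + j by rewrite dE aE; ring.
    have M : (l - 1) * m + m = l * m by case: (l) l0 => // c _; rewrite subn1 mulSn addnC.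
    exists (j - 1); first by lia.
    apply: joins_sym; apply: JE (VZ f) _ _; rewrite ?fj /S; lia.
  case: (ltnP (3 * l + 1) a) => a3l2; last first.
    have aE : a = 3 * l + 1 by lia.
    have dE' : d = 3 * (l * m) + m + j by rewrite dE aE; ring.
    exists S; first by rewrite /S; lia.
    apply: JE (UU f 0 l0) _ _; rewrite ?fj /S; lia.
  have [i iE] : exists i, a = 3 * l + 2 + i by exists (a - 3 * l - 2); lia.
  have il : i < l by lia.
  have M := mul _ _ il.
  have dE' : d = 3 * (l * m) + 2 * m + i * m + j by rewrite dE iE; ring.
  exists (S + 2 * j - 1 + i * m); first by rewrite /S; lia.
  (* The head is the fixed point only for a = 4l + 1 and j = m; then d = 4lm + 2m, beyond the range
     assumed for d. *)
  have := VV f i il; rewrite fj /orbit_W; case: and3P => [[oo /eqP il' /eqP jm']|_].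
    have M2 : l * m = i * m + m by rewrite -il' mulSn addnC.
    by rewrite oo in d0; lia.
  by move=> J; apply: JE J _ _; rewrite /S; lia.
- move=> oo []; exists (S + 2 * m - 1 + (l - 1) * m); split.
    have M : (l - 1) * m + m = l * m by case: (l) l0 => // c _; rewrite subn1 mulSn addnC.
    by rewrite /S; lia.
  have m1 : m.-1 < m by lia.
  have l1 : l - 1 < l by lia.
  apply: joins_sym; have := @joins_VV l _ _ orbit_sun (Ordinal m1) _ _ _ l0 erefl 0 l0.
  rewrite subn0 /orbit_W /= oo !subn1 !prednK //.
  by rewrite !eqxx.
- by rewrite card_unit.
- rewrite card_unit card_ord card_void muln1 addn0.
  case: (o) NE => /=.
    rewrite addnK => E; have -> : N'.+1 + 1 = 4 * (k * m) by rewrite /k; nia.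
    by ring.
  rewrite !addn0 => E; have -> : N'.+1 - 1 = 4 * (k * m) by rewrite /k; nia.
  by ring.
Qed.

End OneOrbit.

(** * The case w = 4m + 3 with m > 0: common framework *)

Section ThreeModFour.
Variables (l m : nat).
Let q := 2 * m + 1.
Let w := (2 * q).+1.
Let k := (2 * l).+1.
Let fb : nat -> 'I_w := fiber (2 * q).
Let point : Type := option ('I_w * nat).

Variable (hG : nat -> nat -> nat -> point).
Variables (h0 h1 h2 h3 : nat -> nat -> point).
Variables (z2 z3 : nat -> point).

Definition side (x : nat) (hd : nat -> point) (b : bool) i : point :=
  if b then hd i else Some (fb x, i).
Definition tip (x : nat) (hd : point) (b : bool) : point :=
  if b then hd else Some (fb x, l).

(* The parameters r = 2j + 2 and s = 2j + 3 are paired off in the first case. The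
   other suns cover the blocks (4c + 2, 1) and (4c + 3, 1); their pendant heads
   [h0, ..., z3], which depend on the parity of l, serve the blocks (4c, 1) and
   (4c + 1, 1) with the help of translation-invariant suns. *)
Definition three4_sun (f : 'I_w * 'I_m + ('I_m.+1 + 'I_m)) :=
  match f with
  | inl (z, j) => zigzag l (@gU q z (2 * j + 2) (hG z j))
      (@gV l q z (2 * j + 2) (2 * j + 3)) (@gZ l q z (2 * j + 3))
  | inr (inl c) => zigzag l (side (4 * c + 1) (h1 c))
      (side (4 * c + 3) (if c == m :> nat then h0 0 else h3 c)) (tip (4 * c + 2) (z2 c))
  | inr (inr c) => zigzag l (side (4 * c + 2) (h2 c)) (side (4 * c + 4) (h0 c.+1))
      (tip (4 * c + 3) (z3 c))
  end.

Let pt := three4_sun.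
Variables (H : finType) (sx sy : H -> 'I_w) (sd se : H -> nat).
Let cv := cov2 k (2 * l) pt sx sy sd se.

Hypothesis l0 : 0 < l.

Lemma cov2_short_differences x y :
    (forall i, i < l -> cv x y i) -> (forall i, 0 < i < l -> cv x y (k - i)) ->
  forall e, e < l \/ l.+1 < e < k -> cv x y e /\ cv y x e.
Proof.
move=> cp cn e eM.
have C e' : e' < l \/ l.+1 < e' < k -> cv x y e'.
  case=> [|e'M]; first exact: cp.
  have -> : e' = k - (k - e') by lia.
  by apply: cn; rewrite /k in e'M *; lia.
split; first exact: C.
case: (posnP e) => e0; first by apply: cov2_sym (C 0 _); lia.
by apply: cov2_sym (C (k - e) _); rewrite /k in eM *; lia.
Qed.

Lemma joins_h1 c i : c <= m -> i < l -> joins k pt (Some (fb (4 * c + 1), i)) (h1 c i).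
Proof.
move=> cm il.
exact: (@joins_UU l _ _ pt (inr (inl (Ordinal (cm : c < m.+1)))) _ _ _ l0 erefl i il).
Qed.

Lemma joins_h3 c i : c < m -> i < l -> joins k pt (Some (fb (4 * c + 3), i)) (h3 c i).
Proof.
move=> cm il.
have := @joins_VV l _ _ pt (inr (inl (Ordinal (ltnW cm : c < m.+1)))) _ _ _ l0 erefl i il.
by rewrite /side /= ltn_eqF.
Qed.

Lemma joins_h2 c i : c < m -> i < l -> joins k pt (Some (fb (4 * c + 2), i)) (h2 c i).
Proof.
move=> cm il.
exact: (@joins_UU l _ _ pt (inr (inr (Ordinal cm))) _ _ _ l0 erefl i il).
Qed.

Lemma joins_h0 c i : c <= m -> i < l -> joins k pt (Some (fb (4 * c), i)) (h0 c i).
Proof.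
case: c => [|c] cm il; last first.
  have -> : 4 * c.+1 = 4 * c + 4 by lia.
  exact: (@joins_VV l _ _ pt (inr (inr (Ordinal cm))) _ _ _ l0 erefl i il).
(* Fibre 0 is 4m + 3 modulo w, the [V] side of the last sun of the first kind; hence the exceptional
   head [h0 0] there. *)
have := @joins_VV l _ _ pt (inr (inl (Ordinal (ltnSn m)))) _ _ _ l0 erefl i il.
rewrite /side /= eqxx; suff -> : fb (4 * m + 3) = fb (4 * 0) by [].
by apply: fiber_shift; rewrite /q; lia.
Qed.

Lemma joins_z2 c : c <= m -> joins k pt (Some (fb (4 * c + 2), l)) (z2 c).
Proof.
move=> cm.
exact: (@joins_ZZ l _ _ pt (inr (inl (Ordinal (cm : c < m.+1)))) _ _ _ l0 erefl).
Qed.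

Lemma joins_z3 c : c < m -> joins k pt (Some (fb (4 * c + 3), l)) (z3 c).
Proof.
by move=> cm; exact: (@joins_ZZ l _ _ pt (inr (inr (Ordinal cm))) _ _ _ l0 erefl).
Qed.

Lemma joins_hG z j i : z < w -> j < m -> i < l ->
  joins k pt (Some (fb (z + (w - (2 * j + 2))), i)) (hG z j i).
Proof.
move=> zw jm il.
exact: (@joins_UU l _ _ pt (inl (Ordinal zw, Ordinal jm)) _ _ _ l0 erefl i il).
Qed.

(** The cycles of 2m + 1 suns take the blocks (4c + 2, 1) and (4c + 3, 1). This leaves 2m + 2 blocks
    of parameter 1, one more than the pendant edges of these suns could fill, so invariant suns have
    to help; the last two hypotheses state what is to be covered jointly. *)
Lemma three4_cov_mix :
    (forall z j i, z < w -> j < m -> i < l ->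
      hG z j i = @gHU q z (2 * j + 2) (2 * j + 3) i \/
      cv (fb (z + (w - (2 * j + 2)))) (fb (z + (w - (2 * j + 2) + 2 * (2 * j + 3)))) i) ->
    (forall c, c <= m -> [/\ forall i, i < l -> cv (fb (4 * c + 1)) (fb (4 * c + (4 * m + 2))) i,
      forall i, 0 < i < l -> cv (fb (4 * c + 1)) (fb (4 * c + (4 * m + 2))) (k - i),
      cv (fb (4 * c + (4 * m + 2))) (fb (4 * c)) l & cv (fb (4 * c + 1)) (fb (4 * c)) l]) ->
    (forall c, c <= m -> [/\ forall i, i < l -> cv (fb (4 * c)) (fb (4 * c + 2)) i,
      forall i, 0 < i < l -> cv (fb (4 * c)) (fb (4 * c + 2)) (k - i),
      cv (fb (4 * c)) (fb (4 * c + 1)) l & cv (fb (4 * c + 2)) (fb (4 * c + 1)) l]) ->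
  forall x y e, x != y -> e < k -> cv x y e.
Proof.
move=> BG B0 B1; apply: cov_mix_blocks => z r zw r0.
case: (eqVneq r 1) => [-> {r r0}|r1].
  have [c cE] : exists c, [\/ c <= m /\ z = 4 * c, c <= m /\ z = 4 * c + 1,
     c <= m /\ z = 4 * c + 2 | c < m /\ z = 4 * c + 3].
    have zE := divn_eq z 4; have lt4 := ltn_pmod z (isT : 0 < 4).
    exists (z %/ 4); move: (z %/ 4) (z %% 4) lt4 zE => c [|[|[|[|?]]]] // _ zE;
      rewrite /q in zw; [constructor 1 | constructor 2 | constructor 3 | constructor 4]; lia.
  case: cE.
  - case=> cm ->; have [C1 C2 C3 C4] := B0 c cm; rewrite /block_covered.
    have -> : fiber (2 * q) (4 * c + ((2 * q).+1 - 1)) = fb (4 * c + (4 * m + 2)).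
      by congr fiber; rewrite /q; lia.
    by split=> // e /(cov2_short_differences C1 C2) [].
  - case=> cm ->; have [C1 C2 C3 C4] := B1 c cm; rewrite /block_covered.
    have -> : fiber (2 * q) (4 * c + 1 + ((2 * q).+1 - 1)) = fb (4 * c).
      by apply: fiber_shift; rewrite /w; lia.
    have -> : 4 * c + 1 + 1 = 4 * c + 2 by lia.
    by split=> // e /(cov2_short_differences C1 C2) [].
  - case=> cm ->.
    pose f : 'I_w * 'I_m + ('I_m.+1 + 'I_m) := inr (inl (Ordinal (cm : c < m.+1))).
    apply: (@block_cycle l q _ _ pt _ _ _ _ l0 f _ _ _ _ _ erefl) => //.
    + move=> i il; rewrite /side /= ; congr (Some (_, _)); apply: fiber_shift; rewrite /w /q; lia.
    + by move=> i il; rewrite /side -addnA.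
  - case=> cm ->.
    apply: (@block_cycle l q _ _ pt _ _ _ _ l0 (inr (inr (Ordinal cm))) _ _ _ _ _ erefl) => //.
    + move=> i il; rewrite /side /= ; congr (Some (_, _)); apply: fiber_shift; rewrite /w /q; lia.
    + by move=> i il; rewrite /side -addnA.
have [[j Rj]|[j Rj]] : (exists j, r = 2 * j + 2) \/ (exists j, r = 2 * j + 3).
  have := odd_double_half (r - 2); case: (odd _) => /= E; [right | left];
    by exists ((r - 2)./2); lia.
  have jm : j < m by rewrite /q in r0; lia.
  rewrite Rj.
  apply: (@block_cycle l q _ _ pt _ _ _ _ l0 (inl (Ordinal zw, Ordinal jm)) _ _ _ _ _ erefl) => //.
  by rewrite /gZ addn0.
have jm : j < m by rewrite /q in r0; lia.
rewrite Rj; apply: (@block_pendant l q _ _ pt _ _ _ _ l0 (2 * j + 2)) => //; try by rewrite /q; lia.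
move=> {}z {}zw; exists (inl (Ordinal zw, Ordinal jm)), (hG z j); split=> // i il.
exact: BG.
Qed.

End ThreeModFour.

(** * The case w = 4m + 3, l odd, no fixed point *)

Section ThreeModFourOdd.
Variables (l m : nat).
Let q := 2 * m + 1.
Let w := (2 * q).+1.
Let k := (2 * l).+1.
Let h := (l + 1)./2.
Let fb : nat -> 'I_w := fiber (2 * q).
Let point : Type := option ('I_w * nat).

(** Heads from 4c and 4c + 1 carry the nonnegative differences of the blocks (4c + 1, 1) and (4c,
    1), those from 4c + 2 and 4c + 3 are pure, and the tips carry l. The fibre 4m + 2 is a side of
    no sun, so all its pure differences fall to invariant suns; in compensation [odd_h0 m] turns
    pure from i = h on. *)
Definition odd_hG z j : nat -> point := @gHU q z (2 * j + 2) (2 * j + 3).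
Definition odd_h0 c i : point :=
  if c == m then if i < h then Some (fb (4 * m + 2), 2 * i) else Some (fb (4 * m), 2 * l - i)
  else Some (fb (4 * c + 2), 2 * i).
Definition odd_h1 c i : point := Some (fb (4 * c + (4 * m + 2)), 2 * i).
Definition odd_h2 c i : point := Some (fb (4 * c + 2), 2 * l - i).
Definition odd_h3 c i : point := Some (fb (4 * c + 3), 2 * l - i).
Definition odd_z2 c : point := Some (fb (4 * c + 1), 2 * l).
Definition odd_z3 c : point := Some (fb (4 * c + 4), 2 * l).
Definition odd_sun := @three4_sun l m odd_hG odd_h0 odd_h1 odd_h2 odd_h3 odd_z2 odd_z3.

Let H : finType := ('I_m.+1 * 'I_l + 'I_m * 'I_l + 'I_h + 'I_l)%type.
(** The suns over 4m + 2 repair the block (4m + 1, 1): read from 4m, their pendant differences are i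
    for i >= h, which [odd_h0 m] gave up, and -(i + h - 1) for 0 < i < h, which the h suns over 4m
    do not reach. *)
Definition odd_short (a : H) : 'I_w * nat * ('I_w * nat) :=
  match a with
  | inl (inl (inl (c, i))) => (fb (4 * c + 1), 2 * (l - i),
      if i == 0 :> nat then (fb (4 * c), l) else (fb (4 * c + (4 * m + 2)), k - i))
  | inl (inl (inr (c, i))) => (fb (4 * c), 2 * (l - i),
      if i == 0 :> nat then (fb (4 * c + 1), l) else (fb (4 * c + 2), k - i))
  | inl (inr i) => (fb (4 * m), 2 * (l - i),
      if i == 0 :> nat then (fb (4 * m + 1), l) else (fb (4 * m + 2), k - i))
  | inr i => (fb (4 * m + 2), 2 * (l - i),
      if i == 0 :> nat then (fb 0, l) else (fb (4 * m), if i < h then i + h - 1 else k - i))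
  end.

Lemma three4_odd_system : prime k -> odd l -> 0 < m ->
  exists B : {set {set complete_graph (k * w + false)} *
    {set {set complete_graph (k * w + false)}}}, sun_system k B.
Proof.
move=> kp ol m0.
have lE : l = (2 * h).-1.
  by have := odd_double_half (l + 1); rewrite oddD ol /= -/h; lia.
have hh : 0 < h by rewrite lt0n; apply: contraTneq ol => h0; rewrite lE h0.
have l0 : 0 < l by lia.
have wE : (2 * q).+1 = 4 * m + 3 by rewrite /q; lia.
pose sx a := (odd_short a).1.1; pose sd a := (odd_short a).1.2.
pose sy a := (odd_short a).2.1; pose se a := (odd_short a).2.2.
have J := @cov2_joins l _ _ _ odd_sun sx sy sd se.
have S a := @cov2_pendant l _ _ H odd_sun sx sy sd se a.
have D a := @cov2_pure l _ _ H odd_sun sx sy sd se a.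
apply: (@cyclic_fiber_system l (2 * q) _ H false odd_sun sx sy sd se) => //.
- move=> f b b' n n' nk nk'; case: f => [[z j]|[c|c]].
  + have jm := ltn_ord j.
    apply: (@generic_sun_inj l q z (2 * j + 2) (2 * j + 3)) nk nk' => //;
      try by rewrite ?wE /q; lia.
    by move=> i _; constructor.
  + have cm := ltn_ord c; apply: zigzag_inj nk nk' => {b b' n n'};
    try (move=> b b' i j il jl; case: b b' => [] []);
    try (move=> b b' i il; case: b b' => [] []);
    rewrite /side /tip /odd_h0 /odd_h1 /odd_h3 /odd_z2; do ?[case: ifP => ?];
    move/fiber_pt_eq; rewrite wE; lia.
  + have cm := ltn_ord c; apply: zigzag_inj nk nk' => {b b' n n'};
    try (move=> b b' i j il jl; case: b b' => [] []);
    try (move=> b b' i il; case: b b' => [] []);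
    rewrite /side /tip /odd_h0 /odd_h2 /odd_z3; do ?[case: ifP => ?];
    move/fiber_pt_eq; rewrite wE; lia.
- move=> f b n x p nk; case: f => [[z j]|[c|c]].
  + by apply: (@generic_sun_lt l q z (2 * j + 2) (2 * j + 3)) nk => i _; constructor.
  + rewrite /odd_sun /three4_sun /zigzag /side /tip /odd_h0 /odd_h1 /odd_h3 /odd_z2.
    have := odd_double_half n; move: (n./2) => a.
    case: (odd n) => /= En; case: b; do ?case: ifP => ?; case=> _ <-; rewrite /k in nk *; lia.
  + rewrite /odd_sun /three4_sun /zigzag /side /tip /odd_h0 /odd_h2 /odd_z3.
    have := odd_double_half n; move: (n./2) => a.
    case: (odd n) => /= En; case: b; do ?case: ifP => ?; case=> _ <-; rewrite /k in nk *; lia.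
- move=> f b n nk; case: f => [[z j]|[c|c]].
  + by move/generic_sun_None => [i _].
  + rewrite /odd_sun /three4_sun /zigzag /side /tip /odd_h0 /odd_h1 /odd_h3 /odd_z2.
    by case: b; do ?case: ifP => ?.
  + rewrite /odd_sun /three4_sun /zigzag /side /tip /odd_h0 /odd_h2 /odd_z3.
    by case: b; do ?case: ifP => ?.
- have ne A B : A < 3 * w -> B < 3 * w -> A <> B -> A <> B + w -> A <> B + 2 * w ->
      B <> A + w -> B <> A + 2 * w -> fb A != fb B.
    by move=> Aw Bw *; apply/eqP => /fiber_eq; rewrite -/w; lia.
  move=> [[[[c i]|[c i]]|i]|i]; rewrite /sx /sy /sd /se /odd_short;
    try have cm := ltn_ord c; have il := ltn_ord i; rewrite /= ?if_arg; do ?case: ifP => ?; split;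
    rewrite /= ?ne //= ?wE /k; lia.
- have pure x i p : i < l -> joins k odd_sun (Some (x, i)) (Some (x, p)) -> p = 2 * l - i ->
      cov2 k (2 * l) odd_sun sx sy sd se x x (2 * (l - i)).
    by move=> il Jx Ep; rewrite Ep in Jx; apply: (J _ _ i (2 * l - i)) => //; lia.
  move=> x i il; rewrite -(fiberK x); have := ltn_ord x; rewrite [X in _ < X]wE => xw.
  have xE := divn_eq x 4; have lt4 := ltn_pmod x (isT : 0 < 4).
  move: (x : nat) (x %/ 4) (x %% 4) xw lt4 xE => {x}n c [|[|[|[|?]]]] // nw _ nE.
  + have -> : n = 4 * c by lia.
    case: (ltnP c m) => cm.
      by apply: (D (inl (inl (inr (Ordinal cm, Ordinal il))))); [left | lia].
    have -> : c = m by lia.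
    case: (ltnP i h) => ih.
      by apply: (D (inl (inr (Ordinal ih)))); [left | lia].
    apply: (pure _ _ (2 * l - i)) => //.
    have := joins_h0 odd_hG odd_h0 odd_h1 odd_h2 odd_h3 odd_z2 odd_z3 l0 (leqnn m) il.
    by rewrite /odd_h0 eqxx ltnNge ih.
  + have cm : c < m.+1 by lia.
    have -> : n = 4 * c + 1 by lia.
    by apply: (D (inl (inl (inl (Ordinal cm, Ordinal il))))); [left | lia].
  + have -> : n = 4 * c + 2 by lia.
    case: (ltnP c m) => cm; last first.
      have -> : c = m by lia.
      by apply: (D (inr (Ordinal il))); [left | lia].
    apply: (pure _ _ (2 * l - i)) => //.
    exact: (joins_h2 odd_hG odd_h0 odd_h1 odd_h2 odd_h3 odd_z2 odd_z3 l0 cm il).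
  + have cm : c < m by lia.
    have -> : n = 4 * c + 3 by lia.
    apply: (pure _ _ (2 * l - i)) => //.
    exact: (joins_h3 odd_hG odd_h0 odd_h1 odd_h2 odd_h3 odd_z2 odd_z3 l0 cm il).
- apply: three4_cov_mix => //.
  + by move=> z j i _ _ _; left.
  + move=> c cm; split.
    * move=> i il; apply: (J _ _ i (2 * i)); try lia.
      exact: (joins_h1 odd_hG odd_h0 odd_h1 odd_h2 odd_h3 odd_z2 odd_z3 l0 cm il).
    * move=> i /andP [i0 il]; have := S (inl (inl (inl (Ordinal (cm : c < m.+1), Ordinal il)))).
      by rewrite /sx /sy /se /= gtn_eqF.
    * case: c cm => [|c] cm; first exact: (S (inr (Ordinal l0))).
      have -> : fiber (2 * q) (4 * c.+1 + (4 * m + 2)) = fb (4 * c + 3).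
        by apply: fiber_shift; rewrite wE; lia.
      have -> : 4 * c.+1 = 4 * c + 4 by lia.
      apply: (J _ _ l (2 * l)); try lia.
      exact: (joins_z3 odd_hG odd_h0 odd_h1 odd_h2 odd_h3 odd_z2 odd_z3 l0 cm).
    * exact: (S (inl (inl (inl (Ordinal (cm : c < m.+1), Ordinal l0))))).
  + move=> c cm.
    have JH i (il : i < l) := joins_h0 odd_hG odd_h0 odd_h1 odd_h2 odd_h3 odd_z2 odd_z3 l0 cm il.
    split.
    * move=> i il; case: (eqVneq c m) => [cE|cn]; last first.
        apply: (J _ _ i (2 * i)); try lia.
        by have := JH i il; rewrite /odd_h0 (negbTE cn).
      case: (ltnP i h) => ih.
        apply: (J _ _ i (2 * i)); try lia.
        by have := JH i il; rewrite /odd_h0 cE eqxx ih.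
      have := S (inr (Ordinal il)); rewrite /sx /sy /se /= gtn_eqF; last lia.
      rewrite ltnNge ih /= cE; apply: cov2_sym; rewrite /k; lia.
    * move=> i /andP [i0 il]; case: (eqVneq c m) => [cE|cn]; last first.
        have cm' : c < m by lia.
        have := S (inl (inl (inr (Ordinal cm', Ordinal il)))).
        by rewrite /sx /sy /se /= gtn_eqF.
      rewrite cE; case: (ltnP i h) => ih.
        have := S (inl (inr (Ordinal ih))).
        by rewrite /sx /sy /se /= gtn_eqF.
      have jl : i - (h - 1) < l by lia.
      have := S (inr (Ordinal jl)); rewrite /sx /sy /se /= gtn_eqF; last lia.
      rewrite (_ : i - (h - 1) < h); last lia.
      have -> : i - (h - 1) + h - 1 = i by lia.
      by rewrite /=; apply: cov2_sym; lia.
    * case: (eqVneq c m) => [->|cn]; first exact: (S (inl (inr (Ordinal hh)))).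
      have cm' : c < m by lia.
      exact: (S (inl (inl (inr (Ordinal cm', Ordinal l0))))).
    * apply: (J _ _ l (2 * l)); try lia.
      exact: (joins_z2 odd_hG odd_h0 odd_h1 odd_h2 odd_h3 odd_z2 odd_z3 l0 cm).
- rewrite !card_sum !card_prod !card_ord /k /w /q addn0 lE.
  have [g ->] : exists g, h = g.+1 by exists h.-1; lia.
  have -> : (2 * (2 * g.+1).-1).+1 * (2 * (2 * m + 1)).+1 - 1 =
     4 * (4 * (g * m) + 3 * g + 3 * m + 2) by lia.
  have -> : (2 * g.+1).-1 = (2 * g).+1 by lia.
  ring.
Qed.

End ThreeModFourOdd.

(** * The case w = 4m + 3, l even, with a fixed point *)

Section ThreeModFourEven.
Variables (h m : nat).
Let l := 2 * h.
Let q := 2 * m + 1.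
Let w := (2 * q).+1.
Let k := (2 * l).+1.
Let fb : nat -> 'I_w := fiber (2 * q).
Let point : Type := option ('I_w * nat).

(* For [j.+1 = m] the edge with [i = 0] would have difference 0 between
   consecutive fibres; these differences are covered elsewhere, which frees the
   edge for the fixed point. *)
Definition even_hG z j i : point :=
  if (j.+1 == m) && (i == 0) then None else @gHU q z (2 * j + 2) (2 * j + 3) i.
Definition even_h0 c i : point :=
  if c == m then if i <= h then Some (fb (4 * m + 2), 2 * i) else Some (fb (4 * m), 2 * l - i)
  else Some (fb (4 * c + 2), 2 * i).
(** A difference 0 is now owed between any two consecutive fibres. [even_z2] for c < m, [even_z3],
    and [even_h1] at c = m, i = 0 pay part of it. The differences l thus displaced from the tips
    move to [even_h2] and [even_h3] at i = 0, and the difference 0 displaced from [even_h1] moves to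
    [even_h3] at i = 1. *)
Definition even_h1 c i : point :=
  if (c == m) && (i == 0) then Some (fb (4 * m + 2), 0)
  else Some (fb (4 * c + (4 * m + 2)), 2 * i).
Definition even_h2 c i : point :=
  if i == 0 then Some (fb (4 * c + 1), l) else Some (fb (4 * c + 2), 2 * l - i).
Definition even_h3 c i : point :=
  if i == 0 then Some (fb (4 * c + 4), l)
  else if (c.+1 == m) && (i == 1) then Some (fb (4 * m + 1), 1)
  else Some (fb (4 * c + 3), 2 * l - i).
Definition even_z2 c : point := Some (fb (4 * c + 1), if c == m then 2 * l else l).
Definition even_z3 c : point := Some (fb (4 * c + 2), l).
Definition even_sun := @three4_sun l m even_hG even_h0 even_h1 even_h2 even_h3 even_z2 even_z3.

Let H : finType :=
  ('I_m.+1 * 'I_l + 'I_m * 'I_l + 'I_h.+1 + 'I_l + 'I_m + 'I_m + unit)%type.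
(** Over 4c + 1, and over 4c with c < m, the pendant edge with i = l - 1 pays a difference 0 between
    consecutive fibres. The difference -(l - 1) that it would have carried goes to the suns over 4c
    + 2 and 4c + 3, which also restore the pure differences lost at i = 0, and for the block (0, 1)
    to i = 1 over 4m + 2. The single last sun restores the pure difference lost at i = 1. *)
Definition even_short (a : H) : 'I_w * nat * ('I_w * nat) :=
  match a with
  | inl (inl (inl (inl (inl (inl (c, i)))))) => (fb (4 * c + 1), 2 * (l - i),
      if i == 0 :> nat then (fb (4 * c), l) else
      if i.+1 == l then (fb (4 * c), 0) else (fb (4 * c + (4 * m + 2)), k - i))
  | inl (inl (inl (inl (inl (inr (c, i)))))) => (fb (4 * c), 2 * (l - i),
      if i == 0 :> nat then (fb (4 * c + 1), l) else
      if i.+1 == l then (fb (4 * c + (4 * m + 2)), 0) else (fb (4 * c + 2), k - i))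
  | inl (inl (inl (inl (inr i)))) => (fb (4 * m), 2 * (l - i),
      if i == 0 :> nat then (fb (4 * m + 1), l) else (fb (4 * m + 2), k - i))
  | inl (inl (inl (inr i))) => (fb (4 * m + 2), 2 * (l - i),
      if i == 0 :> nat then (fb 0, l) else if i == 1 :> nat then (fb 1, l - 1) else
      (fb (4 * m), if i <= h then h + i - 1 else k - i))
  | inl (inl (inr c)) => (fb (4 * c + 2), 2 * l, (fb (4 * c), l - 1))
  | inl (inr c) => (fb (4 * c + 3), 2 * l, (fb (4 * c + 5), l - 1))
  | inr _ => (fb (4 * m - 1), 2 * l - 2, (fb (4 * m), 0))
  end.

Lemma three4_even_system : prime k -> 0 < h -> 0 < m ->
  exists B : {set {set complete_graph (k * w + true)} *
    {set {set complete_graph (k * w + true)}}}, sun_system k B.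
Proof.
move=> kp hh m0.
have lE : l = 2 * h by [].
have l0 : 0 < l by lia.
have wE : (2 * q).+1 = 4 * m + 3 by rewrite /q; lia.
pose sx a := (even_short a).1.1; pose sd a := (even_short a).1.2.
pose sy a := (even_short a).2.1; pose se a := (even_short a).2.2.
have J := @cov2_joins l _ _ _ even_sun sx sy sd se.
have S a := @cov2_pendant l _ _ H even_sun sx sy sd se a.
have D a := @cov2_pure l _ _ H even_sun sx sy sd se a.
apply: (@cyclic_fiber_system l (2 * q) _ H true even_sun sx sy sd se) => //.
- move=> f b b' n n' nk nk'; case: f => [[z j]|[c|c]].
  + have jm := ltn_ord j.
    apply: (@generic_sun_inj l q z (2 * j + 2) (2 * j + 3)) nk nk' => //;
      try by rewrite ?wE /q; lia.
      by move=> i _; rewrite /even_hG; case: ifP => _; constructor.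
    by move=> i i' _ _; rewrite /even_hG; do 2!case: ifP => //; lia.
  + have cm := ltn_ord c; apply: zigzag_inj nk nk' => {b b' n n'};
    try (move=> b b' i j il jl; case: b b' => [] []);
    try (move=> b b' i il; case: b b' => [] []);
    rewrite /side /tip /even_h0 /even_h1 /even_h3 /even_z2; do ?[case: ifP => ?];
    move/fiber_pt_eq; rewrite wE; lia.
  + have cm := ltn_ord c; apply: zigzag_inj nk nk' => {b b' n n'};
    try (move=> b b' i j il jl; case: b b' => [] []);
    try (move=> b b' i il; case: b b' => [] []);
    rewrite /side /tip /even_h0 /even_h2 /even_z3; do ?[case: ifP => ?];
    move/fiber_pt_eq; rewrite wE; lia.
- move=> f b n x p nk; case: f => [[z j]|[c|c]].
  + apply: (@generic_sun_lt l q z (2 * j + 2) (2 * j + 3)) nk => i _.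
    by rewrite /even_hG; case: ifP => _; constructor.
  + rewrite /even_sun /three4_sun /zigzag /side /tip /even_h0 /even_h1 /even_h3 /even_z2.
    have := odd_double_half n; move: (n./2) => a.
    case: (odd n) => /= En; case: b; do ?case: ifP => ?; case=> _ <-; rewrite /k in nk *; lia.
  + rewrite /even_sun /three4_sun /zigzag /side /tip /even_h0 /even_h2 /even_z3.
    have := odd_double_half n; move: (n./2) => a.
    case: (odd n) => /= En; case: b; do ?case: ifP => ?; case=> _ <-; rewrite /k in nk *; lia.
- have ne A B : A < 3 * w -> B < 3 * w -> A <> B -> A <> B + w -> A <> B + 2 * w ->
      B <> A + w -> B <> A + 2 * w -> fb A != fb B.
    by move=> Aw Bw *; apply/eqP => /fiber_eq; rewrite -/w; lia.
  move=> [[[[[[[c i]|[c i]]|i]|i]|c]|c]|u]; rewrite /sx /sy /sd /se /even_short;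
    try have cm := ltn_ord c; try have il := ltn_ord i;
    rewrite /= ?if_arg; do ?case: ifP => ?; split;
    rewrite /= ?ne //= ?wE /k; lia.
- have pure x i p : i < l -> joins k even_sun (Some (x, i)) (Some (x, p)) -> p = 2 * l - i ->
      cov2 k (2 * l) even_sun sx sy sd se x x (2 * (l - i)).
    by move=> il Jx Ep; rewrite Ep in Jx; apply: (J _ _ i (2 * l - i)) => //; lia.
  move=> x i il; rewrite -(fiberK x); have := ltn_ord x; rewrite [X in _ < X]wE => xw.
  have xE := divn_eq x 4; have lt4 := ltn_pmod x (isT : 0 < 4).
  move: (x : nat) (x %/ 4) (x %% 4) xw lt4 xE => {x}n c [|[|[|[|?]]]] // nw _ nE.
  + have -> : n = 4 * c by lia.
    case: (ltnP c m) => cm.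
      by apply: (D (inl (inl (inl (inl (inl (inr (Ordinal cm, Ordinal il)))))))); [left | lia].
    have -> : c = m by lia.
    case: (leqP i h) => ih.
      by apply: (D (inl (inl (inl (inl (inr (Ordinal (ih : i < h.+1)))))))); [left | lia].
    apply: (pure _ _ (2 * l - i)) => //.
    have := joins_h0 even_hG even_h0 even_h1 even_h2 even_h3 even_z2 even_z3 l0 (leqnn m) il.
    by rewrite /even_h0 eqxx leqNgt ih.
  + have cm : c < m.+1 by lia.
    have -> : n = 4 * c + 1 by lia.
    by apply: (D (inl (inl (inl (inl (inl (inl (Ordinal cm, Ordinal il)))))))); [left | lia].
  + have -> : n = 4 * c + 2 by lia.
    case: (ltnP c m) => cm; last first.
      have -> : c = m by lia.
      by apply: (D (inl (inl (inl (inr (Ordinal il)))))); [left | lia].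
    case: (posnP i) => i0.
      by apply: (D (inl (inl (inr (Ordinal cm))))); rewrite i0; [left; rewrite subn0 | lia].
    apply: (pure _ _ (2 * l - i)) => //.
    have := joins_h2 even_hG even_h0 even_h1 even_h2 even_h3 even_z2 even_z3 l0 cm il.
    by rewrite /even_h2 gtn_eqF.
  + have cm : c < m by lia.
    have -> : n = 4 * c + 3 by lia.
    case: (posnP i) => i0.
      by apply: (D (inl (inr (Ordinal cm)))); rewrite i0; [left; rewrite subn0 | lia].
    case: (boolP ((c.+1 == m) && (i == 1))) => [/andP [/eqP cE /eqP i1]|ci].
      have -> : 4 * c + 3 = 4 * m - 1 by lia.
      by apply: (D (inr tt)); rewrite i1; [left; rewrite /sd /=; lia | lia].
    apply: (pure _ _ (2 * l - i)) => //.
    have := joins_h3 even_hG even_h0 even_h1 even_h2 even_h3 even_z2 even_z3 l0 cm il.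
    by rewrite /even_h3 gtn_eqF // (negbTE ci).
- have J2 c (cm : c <= m) := joins_z2 even_hG even_h0 even_h1 even_h2 even_h3 even_z2 even_z3 l0 cm.
  have JH0 c i (cm : c <= m) (il : i < l) :=
    joins_h0 even_hG even_h0 even_h1 even_h2 even_h3 even_z2 even_z3 l0 cm il.
  have JH1 c i (cm : c <= m) (il : i < l) :=
    joins_h1 even_hG even_h0 even_h1 even_h2 even_h3 even_z2 even_z3 l0 cm il.
  have JH3 c i (cm : c < m) (il : i < l) :=
    joins_h3 even_hG even_h0 even_h1 even_h2 even_h3 even_z2 even_z3 l0 cm il.
  have ll : l.-1 < l by lia.
  have l2 : 1 < l by lia.
  (* For s = 2m + 1 one has 2s = w - 1, so the edges given up to the fixed point ran from a fibre y
     + 1 to y with difference 0. *)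
  have DD y : y < 4 * m + 3 -> cov2 k (2 * l) even_sun sx sy sd se (fb (y + 1)) (fb y) 0.
    have yE := divn_eq y 4; have lt4 := ltn_pmod y (isT : 0 < 4).
    move: (y %/ 4) (y %% 4) yE lt4 => c [|[|[|[|?]]]] // yE _ yw.
    + have -> : y = 4 * c by lia.
      have cm : c < m.+1 by lia.
      have := S (inl (inl (inl (inl (inl (inl (Ordinal cm, Ordinal ll))))))).
      by rewrite /sx /sy /se /= gtn_eqF ?prednK ?eqxx //; lia.
    + have -> : y = 4 * c + 1 by lia.
      have cm : c <= m by lia.
      rewrite -addnA; case: (eqVneq c m) => [->|cn].
        have := JH1 m 0 (leqnn m) l0; rewrite /even_h1 !eqxx => C.
        apply: (@cov2_sym _ _ _ _ _ _ _ _ _ _ _ 0) => //; first by left.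
        by apply: (J _ _ 0 0) => //; left.
      have := J2 c cm; rewrite /even_z2 (negbTE cn) => C.
      by apply: (J _ _ l l) => //; lia.
    + have -> : y = 4 * c + 2 by lia.
      case: (ltnP c m) => cm; last first.
        have -> : c = m by lia.
        have := S (inl (inl (inl (inl (inl (inr (Ordinal m0, Ordinal ll))))))).
        rewrite /sx /sy /se /= gtn_eqF ?prednK ?eqxx //; last by lia.
        suff -> : fb (4 * m + 2 + 1) = fb (4 * 0) by [].
        by apply: fiber_shift; rewrite wE; lia.
      rewrite -addnA; apply: (J _ _ l l) => //; try lia.
      exact: (joins_z3 even_hG even_h0 even_h1 even_h2 even_h3 even_z2 even_z3 l0 cm).
    + have -> : y = 4 * c + 3 by lia.
      have cm : c < m by lia.
      have -> : 4 * c + 3 + 1 = 4 * c.+1 by lia.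
      case: (ltnP c.+1 m) => cm'.
        have := S (inl (inl (inl (inl (inl (inr (Ordinal cm', Ordinal ll))))))).
        rewrite /sx /sy /se /= gtn_eqF ?prednK ?eqxx //; last by lia.
        suff -> : fb (4 * c.+1 + (4 * m + 2)) = fb (4 * c + 3) by [].
        by apply: fiber_shift; rewrite wE; lia.
      have -> : c.+1 = m by lia.
      have -> : 4 * c + 3 = 4 * m - 1 by lia.
      apply: (@cov2_sym _ _ _ _ _ _ _ _ _ _ _ 0) => //; first by left.
      exact: (S (inr tt)).
  apply: three4_cov_mix => //.
  + move=> z j i zw jm il; rewrite /even_hG; case: ifP => [/andP [/eqP jE /eqP ->]|_]; last by left.
    right; set u := (_ + (_ + _)); have uE : u = z + (2 * m + 2) + w by rewrite /u /q /w wE; lia.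
    have := DD ((z + (2 * m + 2)) %% (4 * m + 3)).
    rewrite ltn_pmod; last by lia.
    rewrite -wE => /(_ isT).
    have M a : fb (a %% w) = fb a by apply: val_inj; rewrite /= !val_fiber modn_mod.
    rewrite -(M (_ + 1)) modnDml !M.
    have -> : fb (z + (2 * m + 2)) = fb u by rewrite uE /fb fiber_addw.
    suff -> : z + (2 * m + 2) + 1 = z + ((2 * (2 * m + 1)).+1 - (2 * j + 2)) by [].
    by rewrite -jE; lia.
  + move=> c cm; split.
    * move=> i il; case: (boolP ((c == m) && (i == 0))) => [/andP [/eqP -> /eqP ->]|ci].
        have cm' : m.-1 < m by lia.
        have := JH3 _ _ cm' l2; rewrite /even_h3 /= prednK // eqxx => C.
        apply: (@cov2_sym _ _ _ _ _ _ _ _ _ _ _ 0) => //; first by left.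
        have -> : fiber (2 * q) (4 * m + (4 * m + 2)) = fb (4 * m.-1 + 3).
          by apply: fiber_shift; rewrite wE; lia.
        by apply: (J _ _ 1 1) => //; [lia | lia | left].
      apply: (J _ _ i (2 * i)); try lia.
      by have := JH1 _ _ cm il; rewrite /even_h1 (negbTE ci).
    * move=> i /andP [i0 il]; case: (eqVneq i.+1 l) => iE; last first.
        have := S (inl (inl (inl (inl (inl (inl (Ordinal (cm : c < m.+1), Ordinal il))))))).
        by rewrite /sx /sy /se /= gtn_eqF // (negbTE iE).
      case: c cm => [|c] cm.
        have := S (inl (inl (inl (inr (Ordinal l2))))); rewrite /sx /sy /se /=.
        by apply: cov2_sym; lia.
      have -> : fiber (2 * q) (4 * c.+1 + (4 * m + 2)) = fb (4 * c + 3).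
        by apply: fiber_shift; rewrite wE; lia.
      have -> : 4 * c.+1 + 1 = 4 * c + 5 by lia.
      have := S (inl (inr (Ordinal cm))); rewrite /sx /sy /se /=.
      by apply: cov2_sym; lia.
    * case: c cm => [|c] cm; first exact: (S (inl (inl (inl (inr (Ordinal l0)))))).
      have -> : fiber (2 * q) (4 * c.+1 + (4 * m + 2)) = fb (4 * c + 3).
        by apply: fiber_shift; rewrite wE; lia.
      have -> : 4 * c.+1 = 4 * c + 4 by lia.
      apply: (J _ _ 0 l); try lia.
      exact: (JH3 _ _ cm l0).
    * exact: (S (inl (inl (inl (inl (inl (inl (Ordinal (cm : c < m.+1), Ordinal l0)))))))).
  + move=> c cm; split.
    * move=> i il; case: (eqVneq c m) => [cE|cn]; last first.
        apply: (J _ _ i (2 * i)); try lia.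
        by have := JH0 _ _ cm il; rewrite /even_h0 (negbTE cn).
      case: (leqP i h) => ih.
        apply: (J _ _ i (2 * i)); try lia.
        by have := JH0 _ _ cm il; rewrite /even_h0 cE eqxx ih.
      have := S (inl (inl (inl (inr (Ordinal il))))); rewrite /sx /sy /se /=.
      rewrite gtn_eqF; last by lia.
      rewrite gtn_eqF; last by lia.
      by rewrite leqNgt ih /= cE; apply: cov2_sym; lia.
    * move=> i /andP [i0 il]; case: (eqVneq c m) => [cE|cn]; last first.
        have cm' : c < m by lia.
        case: (eqVneq i.+1 l) => iE; last first.
          have := S (inl (inl (inl (inl (inl (inr (Ordinal cm', Ordinal il))))))).
          by rewrite /sx /sy /se /= gtn_eqF // (negbTE iE).
        have := S (inl (inl (inr (Ordinal cm')))); rewrite /sx /sy /se /=.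
        by apply: cov2_sym; lia.
      rewrite cE; case: (leqP i h) => ih.
        have := S (inl (inl (inl (inl (inr (Ordinal (ih : i < h.+1))))))).
        by rewrite /sx /sy /se /= gtn_eqF.
      have jl : i - h + 1 < l by lia.
      have := S (inl (inl (inl (inr (Ordinal jl))))); rewrite /sx /sy /se /=.
      rewrite gtn_eqF; last by lia.
      rewrite gtn_eqF; last by lia.
      rewrite (_ : i - h + 1 <= h); last by lia.
      have -> : h + (i - h + 1) - 1 = i by lia.
      by rewrite /=; apply: cov2_sym; lia.
    * case: (eqVneq c m) => [->|cn].
        exact: (S (inl (inl (inl (inl (inr (Ordinal (ltn0Sn h)))))))).
      have cm' : c < m by lia.
      exact: (S (inl (inl (inl (inl (inl (inr (Ordinal cm', Ordinal l0)))))))).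
    * case: (eqVneq c m) => [->|cn].
        apply: (J _ _ l (2 * l)); try lia.
        by have := J2 m (leqnn m); rewrite /even_z2 eqxx.
      have cm' : c < m by lia.
      apply: (J _ _ 0 l); try lia.
      exact: (joins_h2 even_hG even_h0 even_h1 even_h2 even_h3 even_z2 even_z3 l0 cm' l0).
- move=> _ x; exists 0; split=> //.
  (* The last pair has r = 2m, so the sun with z = x + 2m has its [U] side over x. *)
  have zw := ltn_pmod (x + 2 * m) (ltn0Sn (2 * q)).
  have jm : m.-1 < m by lia.
  have := joins_hG even_hG even_h0 even_h1 even_h2 even_h3 even_z2 even_z3 l0 zw jm l0.
  rewrite /even_hG prednK // !eqxx /= => /joins_sym.
  suff -> : fiber (2 * (2 * m + 1)) ((x + 2 * m) %% (2 * q).+1 +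
    ((2 * (2 * m + 1)).+1 - (2 * m.-1 + 2))) = x by [].
  apply: val_inj; rewrite /= val_fiber modnDml -[RHS](modn_small (ltn_ord x)).
  by rewrite -[in RHS](modnDr x); congr (_ %% _); lia.
- rewrite !card_sum !card_prod !card_ord card_unit /k /w /q /l /=.
  have -> : (2 * (2 * h)).+1 * (2 * (2 * m + 1)).+1 + true - 1 =
     (2 * (2 * h)).+1 * (2 * (2 * m + 1)).+1 by lia.
  ring.
Qed.

End ThreeModFourEven.

(** * Assembling the cases *)

Lemma three4_system l m : prime (2 * l).+1 -> 0 < l ->
  exists B : {set {set complete_graph ((2 * l).+1 * (4 * m + 3) + ~~ odd l)} *
    {set {set complete_graph ((2 * l).+1 * (4 * m + 3) + ~~ odd l)}}},
    sun_system (2 * l).+1 B.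
Proof.
case: (boolP (odd l)) => [ol|/even_halfK <-]; last move: (l./2) => h.
  move=> kp l0; case: (posnP m) => [->|m0]; first exact: three_system.
  have -> : 4 * m + 3 = (2 * (2 * m + 1)).+1 by lia.
  exact: three4_odd_system.
rewrite -mul2n /= => kp h0; have {}h0 : 0 < h by lia.
case: (posnP m) => [->|m0]; first exact: three1_system.
have -> : 4 * m + 3 = (2 * (2 * m + 1)).+1 by lia.
exact: three4_even_system.
Qed.

(** Modulo 4 the hypothesis rules out even w, and for odd w it makes the fixed point present exactly
    when l is odd (w = 4m + 1) or even (w = 4m + 3). The bound v >= 2p excludes w = 1. *)
Lemma mixed_system l w v (o : bool) : prime (2 * l).+1 -> 0 < l -> 2 * (2 * l).+1 <= v ->
    v = (2 * l).+1 * w + o -> 4 %| v - ~~ o ->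
  exists B : {set {set complete_graph v} * {set {set complete_graph v}}},
    sun_system (2 * l).+1 B.
Proof.
move=> kp l0 v2 vE /dvdnP [u uE]; have lE := odd_double_half l.
have wE := divn_eq w 4; have lt4 := ltn_pmod w (isT : 0 < 4).
move: (w %/ 4) (w %% 4) wE lt4 => m [|[|[|[|?]]]] // wE _; rewrite wE in vE.
- by exfalso; clear -vE uE v2; case: o vE uE => /=; lia.
- have m0 : 0 < m.
    by rewrite lt0n; apply: contraTneq v2 => m0; rewrite vE m0; clear -l0; case: o; lia.
  have -> : v = (2 * l).+1 * (2 * (2 * m)).+1 + odd l.
    by clear -lE vE uE v2; move: lE vE uE; case: (odd l); case: (o) => /=; lia.
  exact: one4_system.
- by exfalso; clear -vE uE v2; case: o vE uE => /=; lia.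
- have -> : v = (2 * l).+1 * (4 * m + 3) + ~~ odd l.
    by clear -lE vE uE v2; move: lE vE uE; case: (odd l); case: (o) => /=; lia.
  exact: three4_system.
Qed.

(** As v and v - 1 are coprime, 4 divides one of them, and so does the prime p. If it is the same
    one, 4p divides it and a single orbit of vertices serves; otherwise p fixes the fibres and 4 the
    parities. *)
Lemma prime_sun_system_exists p v : prime p -> odd p -> 2 * p <= v ->
    4 * p %| v * (v - 1) ->
  exists B : {set {set complete_graph v} * {set {set complete_graph v}}}, sun_system p B.
Proof.
move=> pp; have := odd_double_half p; move: (p./2) => l pE po; rewrite po in pE.
have {}pE : p = (2 * l).+1 by lia.
subst p => v2 dv; have l0 : 0 < l by move: pp; case: (l).
have split4 : 4 %| v \/ 4 %| v - 1.
  have : 4 %| v * (v - 1) by apply: dvdn_trans dv; apply: dvdn_mulr.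
  case: (boolP (odd v)) => ov.
    by rewrite mulnC (@Gauss_dvdl 4) ?(@coprimeXl 2 2) ?coprime2n //; right.
  rewrite (@Gauss_dvdl 4) ?(@coprimeXl 2 2) ?coprime2n ?oddB ?(negbTE ov) //; last by lia.
  by left.
have splitp : (2 * l).+1 %| v \/ (2 * l).+1 %| v - 1.
  by apply/orP; rewrite -Euclid_dvdM //; apply: dvdn_trans dv; exact: dvdn_mull.
have cop : coprime 4 (2 * l).+1 by rewrite (@coprimeXl 2 2) ?coprime2n.
case: split4 => d4; case: splitp => dp.
- have : 4 * (2 * l).+1 %| v by rewrite Gauss_dvd // d4.
  case/dvdnP=> m vE; have m0 : 0 < m by lia.
  have -> : v = 4 * (2 * l).+1 * m + (~~ true) by rewrite /=; lia.
  exact: one_orbit_system.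
- case/dvdnP: dp => w vE.
  apply: (@mixed_system l w v true) => //; last by rewrite subn0.
  by rewrite mulnC -vE subnK //; lia.
- case/dvdnP: dp => w vE.
  by apply: (@mixed_system l w v false) => //; rewrite mulnC -vE addn0.
- have : 4 * (2 * l).+1 %| v - 1 by rewrite Gauss_dvd // d4.
  case/dvdnP=> m vE; have m0 : 0 < m by lia.
  have -> : v = 4 * (2 * l).+1 * m + (~~ false) by rewrite /=; lia.
  exact: one_orbit_system.
Qed.

Theorem theorem1p2 (p v : nat) (p_prime : prime p) (p_odd : odd p)
    (v_gt1 : 1 < v) :
  (exists B : {set {set complete_graph v} * {set {set complete_graph v}}},
      sun_system p B) <->
  (2 * p <= v /\ v * (v - 1) = 0 %[mod 4 * p]).
Proof.
have p2 : 2 < p by case: p p_prime p_odd => [|[|[|]]].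
split=> [[B] /(sun_system_necessary p2 v_gt1) [-> d]|[v2 d]].
  by split=> //; apply/eqP; rewrite mod0n.
by apply: prime_sun_system_exists => //; apply/eqP; rewrite d mod0n.
Qed.
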